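(* Let $R=R'_1$. For $t\ge0$ write $t=11\ell+r$, $0\le r\le 10$, $m=\lfloor r/2\rfloor$. Then: (a) $\dim_K\mathrm{HH}^0(R)=3$. (b) $\dim_K\mathrm{HH}^t(R)=2$ if $r\in\{0,10\}$, $t>0$, $\ell+m$ even, $\mathrm{char}K=3$; or if $r\in\{4,6\}$, $\ell+m$ odd, $\mathrm{char}K=3$. (c) $\dim_K\mathrm{HH}^t(R)=1$ if one of: $r\in\{0,10\}$, $t>0$, $\ell+m$ even, $\mathrm{char}K\ne3$; $r\in\{1,9\}$; $r\in\{2,8\}$, $\ell+m$ even; $r=3$ and ($\ell+m$ even or $\mathrm{char}K=2$); $r\in\{4,6\}$, $\ell+m$ even, $\mathrm{char}K=2$; $r\in\{4,6\}$, $\ell+m$ odd, $\mathrm{char}K\ne3$; $r=5$, $\mathrm{char}K=3$; $r=7$ and ($\ell+m$ odd or $\mathrm{char}K=2$). (d) In all other cases $\dim_K\mathrm{HH}^t(R)=0$.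
   Context: Let $K$ be a field, $s=1$, $n=6$. Let $\mathcal Q_s$ be the quiver with $6s$ vertices labelled by integers: for $j\in\mathbb Z$ the labels $4j$ and $4j+3$ depend only on $j$ modulo $s$, and the labels $4j+1$, $4j+2$ depend only on $j$ modulo $2s$. Arrows, for $t\in\mathbb Z$ (indices of $\alpha$ modulo $6s$, of $\gamma$ modulo $s$): $\alpha_{3t}:4t\to 4t+1$, $\alpha_{3t+1}:4t+1\to4t+2$, $\alpha_{3t+2}:4t+2\to 4t+3$, $\gamma_t:4t+3\to 4(t+1)$. Paths are composed right to left. $R=R'_s=K\mathcal Q_s/I'$, $I'$ generated by all paths of length $5$, by $\alpha_{3t+2}\alpha_{3t+1}\alpha_{3t}-\alpha_{3(t+s)+2}\alpha_{3(t+s)+1}\alpha_{3(t+s)}$ and by $\alpha_{3t}\gamma_{t-1}\alpha_{3(t+s)-1}$ ($t\in\mathbb Z$). $\mathrm{HH}^t(R)$ is the $t$-th Hochschild cohomology group of $R$ with coefficients in $R$. *)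

(* Defs.v *)
From HB Require Import structures.
From mathcomp Require Import all_boot all_order all_algebra.
Set Implicit Arguments. Unset Strict Implicit. Unset Printing Implicit Defensive.
Import Order.TTheory GRing.Theory Num.Theory.
Local Open Scope ring_scope.

(* Part 1. Hochschild cohomology of a finite-dimensional K-algebra given by *)
(* a basis indexed by 'I_d and structure constants mul i j : 'rV_d          *)
(* (coordinates of b_i * b_j).  HH^t is the t-th cohomology of the          *)
(* Hochschild cochain complex C^t = Hom_K(A^{(x) t}, A); a cochain is        *)
(* determined by its values on basis tensors b_{x 0} (x) ... (x) b_{x (t-1)}, *)
(* hence is a finite function {ffun 'I_t -> 'I_d} -> 'rV_d.                  *)
Section Hochschild.
Variables (K : fieldType) (d : nat) (mul : 'I_d -> 'I_d -> 'rV[K]_d).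

Definition cochain (t : nat) := {ffun {ffun 'I_t -> 'I_d} -> 'rV[K]_d}.

Definition lmulb (k : 'I_d) (v : 'rV[K]_d) : 'rV[K]_d :=
  \sum_(j < d) v 0 j *: mul k j.
Definition rmulb (v : 'rV[K]_d) (k : 'I_d) : 'rV[K]_d :=
  \sum_(j < d) v 0 j *: mul j k.

Definition drop_first t (x : {ffun 'I_t.+1 -> 'I_d}) : {ffun 'I_t -> 'I_d} :=
  [ffun j : 'I_t => x (inord j.+1)].
Definition drop_last t (x : {ffun 'I_t.+1 -> 'I_d}) : {ffun 'I_t -> 'I_d} :=
  [ffun j : 'I_t => x (inord j)].
Definition merge_at t (x : {ffun 'I_t.+1 -> 'I_d}) (i : nat) (k : 'I_d)
  : {ffun 'I_t -> 'I_d} :=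
  [ffun j : 'I_t => if (j < i)%N then x (inord j)
                    else if (j == i :> nat) then k else x (inord j.+1)].

Definition hdiff t (f : cochain t) : cochain t.+1 :=
  [ffun x : {ffun 'I_t.+1 -> 'I_d} =>
     lmulb (x ord0) (f (drop_first x))
   + \sum_(i < t) ((-1) ^+ i.+1 *:
        \sum_(k < d) (mul (x (inord i)) (x (inord i.+1)) 0 k *: f (merge_at x i k)))
   + (-1) ^+ t.+1 *: rmulb (f (drop_last x)) (x ord_max)].

Definition HHdim (t : nat) : nat :=
  (\dim (lker (linfun (@hdiff t))) -
   match t with 0 => 0 | t'.+1 => \dim (limg (linfun (@hdiff t'))) end)%N.

End Hochschild.

(* Part 2. The algebra R = R'_1 = K Q_1 / I'.                               *)
(* Vertices of Q_1 (s = 1): 0, 1, 2, 3, 5, 6.                               *)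
(* Arrows, coded by nat:  0 = alpha_0 : 0 -> 1,  1 = alpha_1 : 1 -> 2,       *)
(*   2 = alpha_2 : 2 -> 3,  3 = alpha_3 : 0 -> 5 (4 = 0),  4 = alpha_4 : 5->6,*)
(*   5 = alpha_5 : 6 -> 3 (7 = 3),  6 = gamma_0 : 3 -> 0 (4 = 0).            *)
(* A path is (start vertex, list of arrows in order of traversal).          *)
(* Relations of I' (s = 1): all paths of length 5;                          *)
(*   alpha_2 alpha_1 alpha_0 = alpha_5 alpha_4 alpha_3;                      *)
(*   alpha_0 gamma alpha_2 = 0, alpha_3 gamma alpha_5 = 0.                   *)
(* Basis of R: paths of length <= 4 containing neither alpha_0 gamma alpha_2*)
(* nor alpha_3 gamma alpha_5 nor alpha_5 alpha_4 alpha_3 (the latter is      *)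
(* rewritten to alpha_2 alpha_1 alpha_0).                                    *)

Definition vertices : seq nat := [:: 0; 1; 2; 3; 5; 6]%N.
Definition arrows : seq nat := iota 0 7.
Definition asrc (a : nat) : nat := nth 0%N [:: 0; 1; 2; 0; 5; 6; 3]%N a.
Definition atgt (a : nat) : nat := nth 0%N [:: 1; 2; 3; 5; 6; 3; 0]%N a.

Fixpoint pathsFrom (v : nat) (L : nat) : seq (seq nat) :=
  match L with
  | 0 => [:: [::]]
  | L'.+1 => flatten [seq [seq a :: p | p <- pathsFrom (atgt a) L']
                     | a <- arrows & asrc a == v]
  end.

Definition path := (nat * seq nat)%type.

Definition ptgt (p : path) : nat := last p.1 [seq atgt a | a <- p.2].

(* relations, as words in order of traversal *)
Definition zero_word1 : seq nat := [:: 2; 6; 0]%N. (* alpha_0 gamma alpha_2 *)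
Definition zero_word2 : seq nat := [:: 5; 6; 3]%N. (* alpha_3 gamma alpha_5 *)
Definition comm_lhs : seq nat := [:: 3; 4; 5]%N.   (* alpha_5 alpha_4 alpha_3 *)
Definition comm_rhs : seq nat := [:: 0; 1; 2]%N.   (* alpha_2 alpha_1 alpha_0 *)

Definition normal_word (w : seq nat) : bool :=
  [&& (size w <= 4)%N, ~~ infix zero_word1 w, ~~ infix zero_word2 w
    & ~~ infix comm_lhs w].

Fixpoint rw_comm (w : seq nat) : seq nat :=
  match w with
  | 3 :: 4 :: 5 :: s => 0 :: 1 :: 2 :: rw_comm s
  | a :: s => a :: rw_comm s
  | [::] => [::]
  end%N.

(* normal form of a (composable) path, None if it is zero in R *)
Definition normalize (p : path) : option path :=
  let w := rw_comm p.2 in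
  if [&& (size w <= 4)%N, ~~ infix zero_word1 w & ~~ infix zero_word2 w]
  then Some (p.1, w) else None.

Definition Rbasis : seq path :=
  [seq vp | vp <- flatten [seq [seq (v, p) | p <- flatten
                              [seq pathsFrom v L | L <- iota 0 5]]
                          | v <- vertices]
          & normal_word vp.2].

Definition dR : nat := size Rbasis.

(* b_i * b_j (composition right to left: first b_j, then b_i) *)
Definition mulR (K : fieldType) (i j : 'I_dR) : 'rV[K]_dR :=
  let bi := nth (0%N, [::]) Rbasis i in
  let bj := nth (0%N, [::]) Rbasis j in
  if ptgt bj == bi.1 then
    match normalize (bj.1, bj.2 ++ bi.2) with
    | Some q => if q \in Rbasis then delta_mx 0 (inord (index q Rbasis)) else 0
    | None => 0
    end
  else 0.

Definition HHdimR (K : fieldType) (t : nat) : nat := HHdim (@mulR K) t.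

(* Main.v *)
Require Import Defs.
From HB Require Import structures.
From mathcomp Require Import all_boot all_order all_algebra.
From mathcomp Require Import zify.
Set Implicit Arguments. Unset Strict Implicit. Unset Printing Implicit Defensive.
Import GRing.Theory.
Local Open Scope ring_scope.

(** Let z(M) be the dimension of the centre {m | am = ma} of an A-bimodule M.
The space Hom_K(A, M) is a bimodule under (b g)(x) = b g(x) and
(g a)(x) = g(ax) - g(a)x; its centre is the space of derivations A -> M, and
currying the last argument identifies HH^(t+1)(A, M) with
HH^t(A, Hom_K(A, M)).  If 0 -> M -> I -> N -> 0 is exact and I is relatively
injective, then derivations into M become inner in I, whence
z(Hom(A, M)) + z(I) = z(N) + dim M.  Along a coresolution
0 -> A -> I_0 -> I_1 -> ... by relatively injective bimodules this gives
dim HH^(t+1)(A, A) = z(ker d_(t+1)) + z(ker d_t) - z(I_t).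

The algebra R is self-injective and has such a coresolution of period 22, in
which I_k is the dual of a sum of bimodules e_i R (x) R e_j.  The centre of the
dual of e_i R (x) R e_j is the dual of e_i R e_j, so z(ker d_k) is the corank
of an integer matrix of size at most 11; its elementary divisors are 1, 3
and 4, which is why only the characteristics 2 and 3 are special. *)

(** * Bimodules and dimension shifting *)

(** The obstacle is that [HHdim] is a difference of dimensions inside cochain spaces of dimension
    34^(t+1), for all t and over every field. Only kernels have to be understood: image dimensions
    follow by rank and nullity, and currying turns a kernel into the centre of an iterated Hom
    bimodule, so that no comparison map from the bar complex to another resolution is constructed.
    Taking centres is left exact, and the dimension formula says that HH^(t+1) is the cokernel of
    z(I_t) -> z(ker d_(t+1)). Everything specific to R becomes a finite identity between signed
    pairs of basis elements. The differentials and a contracting homotopy are lists of terms with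
    signs, so their relations are checked once, by cancelling opposite terms, and then hold over
    every field. The homotopy is linear only in the right factor, hence it is listed separately for
    each left basis element. A rank over K is certified from above by a factorization and from below
    by producing a nonzero multiple of an identity matrix, over the integers and once more modulo
    the exceptional prime. *)

(** The evaluation rule [lfunE] asks for a packed linear map; packing one from a proof of linearity
    makes bare functions such as [hdiff] in [HHdim] computable under [linfun]. *)
Lemma linfunE (K : fieldType) (U V : vectType K) (f : U -> V) :
  linear f -> forall v, linfun f v = f v.
Proof.
move=> lf v; pose lfM := GRing.isLinear.Build K U V *:%R f lf.
pose g : {linear U -> V} := HB.pack f lfM.
exact: (lfunE g v).
Qed.

Lemma dim_img_inj (K : fieldType) (U V : vectType K) (f : 'Hom(U, V))
    (W : {vspace U}) :
  lker f = 0%VS -> \dim (f @: W) = \dim W.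
Proof. by move=> f0; rewrite limg_dim_eq // f0 capv0. Qed.

Section Bimodules.
Variables (K : fieldType) (d : nat) (mul : 'I_d -> 'I_d -> 'rV[K]_d).

(** No unit axiom can be imposed: in [homB M] below (g 1)(x) = g(x) - g(1)x, so 1 does not act on
    the right as the identity. *)
Record bimod := Bimod {
  bcar :> vectType K;
  lact : 'I_d -> 'End(bcar);
  ract : 'I_d -> 'End(bcar);
  lactA : forall a b v, lact a (lact b v) = \sum_k mul a b 0 k *: lact k v;
  ractA : forall a b v, ract b (ract a v) = \sum_k mul a b 0 k *: ract k v;
  lractC : forall a b v, lact a (ract b v) = ract b (lact a v) }.

Definition bmor (M N : bimod) (f : 'Hom(M, N)) :=
  (forall a v, f (lact M a v) = lact N a (f v)) /\
  (forall a v, f (ract M a v) = ract N a (f v)).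

Hypothesis mulA : forall a b c l,
  \sum_k mul a b 0 k * mul k c 0 l = \sum_k mul b c 0 k * mul a k 0 l.

(** * The bimodule Hom_K(A, M) and its derivations *)

Section HomBimod.
Variable M : bimod.
Local Notation HM := {ffun 'I_d -> M}.

Definition hom_lact_fun (b : 'I_d) (g : HM) : HM := [ffun x => lact M b (g x)].
Definition hom_ract_fun (a : 'I_d) (g : HM) : HM :=
  [ffun x => \sum_k mul a x 0 k *: g k - ract M x (g a)].
Definition hom_lact b : 'End(HM) := linfun (hom_lact_fun b).
Definition hom_ract a : 'End(HM) := linfun (hom_ract_fun a).

Lemma hom_lactE b g x : hom_lact b g x = lact M b (g x).
Proof.
rewrite linfunE ?ffunE // => c u v; apply/ffunP => y.
by rewrite !ffunE linearP.
Qed.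

Lemma hom_ractE a g x :
  hom_ract a g x = \sum_k mul a x 0 k *: g k - ract M x (g a).
Proof.
rewrite linfunE ?ffunE // => c u v; apply/ffunP => y.
rewrite !ffunE linearP opprD scalerBr addrACA; congr (_ + _).
rewrite scaler_sumr -big_split /=; apply: eq_bigr => k _.
by rewrite !ffunE scalerDr !scalerA [_ * c]mulrC.
Qed.

Lemma hom_lactA a b v :
  hom_lact a (hom_lact b v) = \sum_k mul a b 0 k *: hom_lact k v.
Proof.
apply/ffunP => x; rewrite !hom_lactE lactA sum_ffunE.
by apply: eq_bigr => k _; rewrite ffunE hom_lactE.
Qed.

(** Expanding ((g a) b)(x) produces g(a)bx twice with opposite signs; what is left agrees by a(bx) =
    (ab)x. *)
Lemma hom_ractA a b v :
  hom_ract b (hom_ract a v) = \sum_k mul a b 0 k *: hom_ract k v.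
Proof.
apply/ffunP => x; rewrite hom_ractE sum_ffunE.
under eq_bigr => k _ do rewrite hom_ractE scalerBr scaler_sumr.
under [RHS]eq_bigr => k _ do rewrite ffunE hom_ractE scalerBr scaler_sumr.
have rS : ract M x (\sum_k mul a b 0 k *: v k) =
    \sum_k mul a b 0 k *: ract M x (v k).
  by rewrite linear_sum; apply: eq_bigr => k _; rewrite linearZ.
rewrite !sumrB hom_ractE linearB /= rS ractA opprB addrCA addrA.
rewrite [X in X - _ = _]addrC -!addrA addKr; congr (_ - _).
rewrite exchange_big [RHS]exchange_big /=; apply: eq_bigr => l _.
under eq_bigr => k _ do rewrite scalerA.
under [RHS]eq_bigr => k _ do rewrite scalerA.
by rewrite -!scaler_suml -mulA.
Qed.

Lemma hom_lractC a b v :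
  hom_lact a (hom_ract b v) = hom_ract b (hom_lact a v).
Proof.
apply/ffunP => x; rewrite hom_lactE !hom_ractE linearB /= hom_lactE -lractC.
congr (_ - _); rewrite linear_sum; apply: eq_bigr => k _.
by rewrite linearZ /= hom_lactE.
Qed.

Definition homB := Bimod hom_lactA hom_ractA hom_lractC.

Definition inner : 'Hom(M, homB) :=
  linfun (fun v => [ffun x => lact M x v - ract M x v] : homB).

Lemma innerE v x : inner v x = lact M x v - ract M x v.
Proof.
rewrite linfunE ?ffunE // => c u w; apply/ffunP => y.
by rewrite !ffunE !linearP /= scalerDr addrACA.
Qed.

Definition center : {vspace M} := lker inner.

Lemma centerP v : reflect (forall a, lact M a v = ract M a v) (v \in center).
Proof.
rewrite memv_ker; apply: (iffP eqP) => [h a|h].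
  by apply/eqP; rewrite -subr_eq0 -innerE h ffunE.
by apply/ffunP => a; rewrite innerE h subrr ffunE.
Qed.
End HomBimod.

Lemma inner_central (M : bimod) v : inner M v \in center (homB M).
Proof.
apply/centerP => a; apply/ffunP => x.
have S : \sum_k mul a x 0 k *: inner M v k =
    lact M a (lact M x v) - ract M x (ract M a v).
  by rewrite lactA ractA -sumrB; apply: eq_bigr => k _; rewrite innerE scalerBr.
rewrite hom_lactE hom_ractE S !innerE !linearB /= lractC opprK addrAC addrA.
by rewrite addrK.
Qed.

Lemma bmor_center (M N : bimod) (f : 'Hom(M, N)) v :
  bmor f -> v \in center M -> f v \in center N.
Proof. by move=> [fL fR] /centerP vC; apply/centerP => a; rewrite -fL -fR vC. Qed.

(** The maps T_k assemble to g |-> sum_k T_k(g(b_k)), a bimodule retraction of the embedding v |->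
    (x |-> xv) of I into Hom_K(A, I), where (ag)(x) = g(xa) and (ga)(x) = g(x)a. *)
Definition relinj (I : bimod) := exists T : 'I_d -> 'End(I),
  [/\ forall v, \sum_k T k (lact I k v) = v,
      forall l a v, lact I a (T l v) = \sum_k mul k a 0 l *: T k v
    & forall l a v, ract I a (T l v) = T l (ract I a v)].

(** For v = sum_k T_k(g(b_k)) the Leibniz rule gives av - va = sum_k T_k(g(b_k a) - g(b_k)a) = sum_k
    T_k(b_k g(a)) = g(a). *)
Lemma relinj_inner I (g : homB I) :
  relinj I -> g \in center (homB I) -> exists v, inner I v = g.
Proof.
move=> [T [T1 TL TR]] /centerP gC; exists (\sum_k T k (g k)).
apply/ffunP => a.
have SL : lact I a (\sum_k T k (g k)) =
    \sum_k \sum_l mul k a 0 l *: T k (g l).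
  by rewrite linear_sum exchange_big; apply: eq_bigr => l _; rewrite /= TL.
have SR : ract I a (\sum_k T k (g k)) = \sum_k T k (ract I a (g k)).
  by rewrite linear_sum; apply: eq_bigr => k _; rewrite /= TR.
rewrite innerE SL SR -sumrB -[RHS]T1; apply: eq_bigr => k _.
have /ffunP/(_ a) := gC k; rewrite hom_lactE hom_ractE => ->.
rewrite linearB linear_sum /=; congr (_ - _).
by apply: eq_bigr => l _; rewrite linearZ.
Qed.

Lemma relinj_homB I : relinj I -> relinj (homB I).
Proof.
move=> [T [T1 TL TR]].
pose Tf k (g : homB I) : homB I := [ffun x => T k (g x)].
have TfE k g x : linfun (Tf k) g x = T k (g x).
  rewrite linfunE ?ffunE // => c u w; apply/ffunP => y.
  by rewrite !ffunE linearP.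
exists (fun k => linfun (Tf k)); split=> [v|l a v|l a v]; apply/ffunP => x.
- rewrite sum_ffunE -[RHS]T1; apply: eq_bigr => k _.
  by rewrite TfE hom_lactE.
- rewrite hom_lactE TfE TL sum_ffunE; apply: eq_bigr => k _.
  by rewrite ffunE TfE.
- rewrite TfE !hom_ractE TfE TR linearB linear_sum /=; congr (_ - _).
  by apply: eq_bigr => k _; rewrite TfE linearZ.
Qed.

Definition homB_map (M N : bimod) (f : 'Hom(M, N)) : 'Hom(homB M, homB N) :=
  linfun (fun g : homB M => [ffun x => f (g x)] : homB N).

Lemma homB_mapE (M N : bimod) (f : 'Hom(M, N)) (g : homB M) x :
  homB_map f g x = f (g x).
Proof.
rewrite linfunE ?ffunE // => c u w; apply/ffunP => y.
by rewrite !ffunE linearP.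
Qed.

Lemma bmor_homB (M N : bimod) (f : 'Hom(M, N)) : bmor f -> bmor (homB_map f).
Proof.
move=> [fL fR]; split=> a v; apply/ffunP => x; rewrite homB_mapE.
  by rewrite !hom_lactE homB_mapE fL.
rewrite !hom_ractE homB_mapE linearB linear_sum /= fR; congr (_ - _).
by apply: eq_bigr => k _; rewrite homB_mapE linearZ.
Qed.

(** * Short exact sequences and dimensions of centres *)

Definition ses (M I N : bimod) (i : 'Hom(M, I)) (p : 'Hom(I, N)) :=
  [/\ bmor i /\ bmor p, lker i = 0%VS, limg i = lker p & limg p = fullv].

Lemma ses_homB (M I N : bimod) (i : 'Hom(M, I)) (p : 'Hom(I, N)) :
  ses i p -> ses (homB_map i) (homB_map p).
Proof.
move=> [[bi bp] i0 ip p1]; split; first by split; apply: bmor_homB.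
- apply/eqP; rewrite -subv0; apply/subvP => g; rewrite memv_ker memv0 => /eqP g0.
  apply/eqP/ffunP => x; rewrite ffunE; apply/eqP; rewrite -memv0 -i0 memv_ker.
  by rewrite -homB_mapE g0 ffunE.
- apply/vspaceP => g; apply/idP/idP.
    move=> /memv_imgP[h _ ->]; rewrite memv_ker; apply/eqP/ffunP => x.
    rewrite !homB_mapE [RHS]ffunE; apply/eqP; rewrite -memv_ker -ip.
    exact: memv_img (memvf _).
  rewrite memv_ker => /eqP g0.
  have gi x : g x \in limg i.
    by rewrite ip memv_ker -homB_mapE g0 ffunE.
  have -> : g = homB_map i [ffun x => (i^-1)%VF (g x)].
    by apply/ffunP => x; rewrite homB_mapE ffunE limg_lfunVK.
  exact: memv_img (memvf _).
- apply/eqP; rewrite eqEsubv subvf /=; apply/subvP => g _.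
  have -> : g = homB_map p [ffun x => (p^-1)%VF (g x)].
    by apply/ffunP => x; rewrite homB_mapE ffunE limg_lfunVK // p1 memvf.
  exact: memv_img (memvf _).
Qed.

Definition zdim (M : bimod) := \dim (center M).

(* Every derivation A -> M becomes inner in I; the elements of I inducing
   derivations into M are those with central image in N. *)
Lemma ses_zdim (M I N : bimod) (i : 'Hom(M, I)) (p : 'Hom(I, N)) :
  relinj I -> ses i p ->
  (zdim (homB M) + zdim I = zdim N + \dim {:M})%N.
Proof.
move=> rI [[bi bp] i0 ip p1].
pose Y := (p @^-1: center N)%VS.
have memY v : (v \in Y) = (p v \in center N) by rewrite -memv_preim.
have dimY : \dim Y = (zdim N + \dim {:M})%N.
  rewrite -(limg_ker_dim p Y) addnC; congr (_ + _)%N.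
    by rewrite /Y lpreimK // p1 subvf.
  rewrite -(dim_img_inj fullv i0) ip; congr (\dim _).
  apply/capv_idPr/subvP => v; rewrite memv_ker memY => /eqP ->.
  exact: mem0v.
rewrite -dimY -(limg_ker_dim (inner I) Y) addnC; congr (_ + _)%N.
  congr (\dim _); apply/esym/capv_idPr/subvP => v /centerP vC.
  by rewrite memY; apply: bmor_center bp _; apply/centerP.
have [Hi Hi0 _ _] : ses (homB_map i) (homB_map p) by apply: ses_homB.
rewrite /zdim -(dim_img_inj _ Hi0); congr (\dim _).
apply/vspaceP => g; apply/memv_imgP/memv_imgP.
  move=> [h hC ->].
  have [|v vE] := relinj_inner (g := homB_map i h) rI.
    exact: bmor_center (proj1 Hi) hC.
  exists v => //; rewrite memY; apply/centerP => a; apply/eqP.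
  rewrite -(proj1 bp) -(proj2 bp) -subr_eq0 -linearB /= -innerE vE homB_mapE.
  by rewrite -memv_ker -ip memv_img ?memvf.
move=> [v vY ->].
have vi x : inner I v x \in limg i.
  have /centerP pC : p v \in center N by rewrite -memY.
  by rewrite ip memv_ker innerE linearB /= (proj1 bp) (proj2 bp) pC subrr.
pose h : homB M := [ffun x => (i^-1)%VF (inner I v x)].
have hE : homB_map i h = inner I v.
  by apply/ffunP => x; rewrite homB_mapE ffunE limg_lfunVK.
exists h => //; apply/centerP => a; apply/eqP; rewrite -subr_eq0 -memv0 -Hi0.
rewrite memv_ker linearB /= (proj1 (proj1 Hi)) (proj2 (proj1 Hi)) hE subr_eq0.
by apply/eqP; have /centerP-> := inner_central v.
Qed.

Lemma ses_dim (M I N : bimod) (i : 'Hom(M, I)) (p : 'Hom(I, N)) :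
  ses i p -> \dim {:I} = (\dim {:M} + \dim {:N})%N.
Proof.
move=> [_ i0 ip p1]; rewrite -(limg_ker_dim p fullv) p1 capfv -ip.
by rewrite (dim_img_inj _ i0).
Qed.

(** Every derivation into I is inner, so [inner] maps onto the centre of [homB I]; its kernel is the
    centre of I. *)
Lemma relinj_zdim I : relinj I -> (zdim (homB I) + zdim I = \dim {:I})%N.
Proof.
move=> rI; rewrite -(limg_ker_dim (inner I) fullv) capfv addnC; congr (_ + _)%N.
congr (\dim _); apply/vspaceP => g; apply/idP/memv_imgP.
  by move=> /(relinj_inner rI)[v <-]; exists v; rewrite ?memvf.
by move=> [v _ ->]; apply: inner_central.
Qed.

Lemma ses_zdim_ker (M I N : bimod) (i : 'Hom(M, I)) (p : 'Hom(I, N)) :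
  ses i p -> zdim M = \dim (center I :&: lker p).
Proof.
move=> [[bi bp] i0 ip p1]; rewrite /zdim -(dim_img_inj _ i0); congr (\dim _).
apply/vspaceP => v; rewrite memv_cap -ip; apply/memv_imgP/andP.
  move=> [u uC ->]; split; last exact: memv_img (memvf _).
  exact: bmor_center bi uC.
move=> [/centerP vC /memv_imgP[u _ vE]]; exists u => //.
apply/centerP => a; apply/eqP; rewrite -subr_eq0 -memv0 -i0 memv_ker linearB.
by rewrite /= (proj1 bi) (proj2 bi) -vE vC subrr.
Qed.

(** * Kernels of bimodule maps *)

Section Kernel.
Variables (M N : bimod) (f : 'Hom(M, N)).
Hypothesis bf : bmor f.
Local Notation U := (subvs_of (lker f)).

Definition ker_act (g : 'End(M)) : 'End(U) :=
  linfun (fun u : U => vsproj (lker f) (g (vsval u))).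

Lemma ker_actE (g : 'End(M)) u :
  (forall v, f v = 0 -> f (g v) = 0) -> vsval (ker_act g u) = g (vsval u).
Proof.
move=> gK; rewrite linfunE; last by move=> c v w; rewrite !linearP.
by rewrite vsprojK // memv_ker gK //; apply/eqP; rewrite -memv_ker subvsP.
Qed.

Lemma ker_lactE a u : vsval (ker_act (lact M a) u) = lact M a (vsval u).
Proof. by apply: ker_actE => v v0; rewrite (proj1 bf) v0 linear0. Qed.

Lemma ker_ractE a u : vsval (ker_act (ract M a) u) = ract M a (vsval u).
Proof. by apply: ker_actE => v v0; rewrite (proj2 bf) v0 linear0. Qed.

Lemma ker_lactA a b v : ker_act (lact M a) (ker_act (lact M b) v) =
  \sum_k mul a b 0 k *: ker_act (lact M k) v.
Proof.
apply: val_inj => /=; rewrite !ker_lactE lactA linear_sum; apply: eq_bigr => k _.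
by rewrite linearZ /= ker_lactE.
Qed.

Lemma ker_ractA a b v : ker_act (ract M b) (ker_act (ract M a) v) =
  \sum_k mul a b 0 k *: ker_act (ract M k) v.
Proof.
apply: val_inj => /=; rewrite !ker_ractE ractA linear_sum; apply: eq_bigr => k _.
by rewrite linearZ /= ker_ractE.
Qed.

Lemma ker_lractC a b v : ker_act (lact M a) (ker_act (ract M b) v) =
  ker_act (ract M b) (ker_act (lact M a) v).
Proof. by apply: val_inj; rewrite /= ker_lactE !ker_ractE ker_lactE lractC. Qed.

Definition kerB := Bimod ker_lactA ker_ractA ker_lractC.

Definition kerB_incl : 'Hom(kerB, M) := linfun (vsval : kerB -> M).

Lemma kerB_inclE u : kerB_incl u = vsval u.
Proof. by rewrite linfunE // => c v w; rewrite linearP. Qed.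

Definition kerB_proj (L : bimod) (g : 'Hom(L, M)) : 'Hom(L, kerB) :=
  linfun (fun v => vsproj (lker f) (g v) : kerB).

Lemma kerB_projE (L : bimod) (g : 'Hom(L, M)) v :
  limg g = lker f -> vsval (kerB_proj g v) = g v.
Proof.
move=> gf; rewrite linfunE; last by move=> c u w; rewrite !linearP.
by rewrite vsprojK // -gf memv_img ?memvf.
Qed.

Lemma limg_kerB_incl : limg kerB_incl = lker f.
Proof.
apply/vspaceP => v; apply/memv_imgP/idP => [[u _ ->]|vf].
  by rewrite kerB_inclE subvsP.
by exists (vsproj (lker f) v); rewrite ?memvf // kerB_inclE vsprojK.
Qed.

Lemma kerB_incl0 : lker kerB_incl = 0%VS.
Proof.
apply/eqP; rewrite -subv0; apply/subvP => u; rewrite memv_ker kerB_inclE memv0.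
move=> /eqP u0; apply/eqP; apply: val_inj; rewrite /= u0.
exact/esym/(linear0 (@vsval _ _ (lker f))).
Qed.

Lemma bmor_kerB_incl : bmor kerB_incl.
Proof. by split=> a u; rewrite !kerB_inclE (ker_lactE, ker_ractE). Qed.

(** Cuts a short exact piece 0 -> A -> L -> ker f -> 0 out of a long exact sequence. *)
Lemma kerB_ses (L A : bimod) (i : 'Hom(A, L)) (g : 'Hom(L, M)) :
  bmor i -> bmor g -> lker i = 0%VS -> limg i = lker g -> limg g = lker f ->
  ses i (kerB_proj g) /\ lker (kerB_proj g) = lker g.
Proof.
move=> bi bg i0 ig gf.
have kE : lker (kerB_proj g) = lker g.
  apply/vspaceP => v; rewrite !memv_ker; apply/eqP/eqP => v0.
    by rewrite -(kerB_projE v gf) v0; exact: (linear0 (@vsval _ _ (lker f))).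
  apply: val_inj; rewrite /= (kerB_projE v gf) v0.
  exact/esym/(linear0 (@vsval _ _ (lker f))).
split=> //; split; rewrite ?kE //.
  split=> //; split=> a v; apply: val_inj.
    by rewrite /= ker_lactE !kerB_projE // (proj1 bg).
  by rewrite /= ker_ractE !kerB_projE // (proj2 bg).
apply/eqP; rewrite eqEsubv subvf /=; apply/subvP => u _.
have : vsval u \in limg g by rewrite gf subvsP.
move=> /memv_imgP[v _ uE]; apply/memv_imgP; exists v; rewrite ?memvf //.
by apply: val_inj; rewrite /= kerB_projE.
Qed.
End Kernel.

(** * Dimension shifting along a coresolution *)

Definition homn t M := iter t homB M.

Lemma ses_homn t (M I N : bimod) (i : 'Hom(M, I)) (p : 'Hom(I, N)) : ses i p ->
  exists (j : 'Hom(homn t M, homn t I)) (q : 'Hom(homn t I, homn t N)), ses j q.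
Proof.
move=> s; elim: t => [|t [j [q jq]]]; first by exists i, p.
by exists (homB_map j), (homB_map q); apply: ses_homB.
Qed.

Lemma relinj_homn t I : relinj I -> relinj (homn t I).
Proof. by move=> rI; elim: t => //= t; apply: relinj_homB. Qed.

(* dim HH^(t+1)(A, M) = n, without subtraction *)
Definition hhdim t M n :=
  (zdim (homn t.+1 M) + zdim (homn t M) = n + \dim {:homn t M})%N.

(** A relatively injective I has no higher cohomology. Numerically, [ses_zdim] is used at the levels
    t and t+1 of [homn], and the contributions of I cancel by [relinj_zdim] and [ses_dim] at level
    t. *)
Lemma hhdim_shift t (M I N : bimod) (i : 'Hom(M, I)) (p : 'Hom(I, N)) n :
  relinj I -> ses i p -> hhdim t N n -> hhdim t.+1 M n.
Proof.
rewrite /hhdim => rI s; have [j [q s1]] := ses_homn t s.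
have rt := relinj_homn t rI; have s2 := ses_homB s1.
have := ses_zdim (relinj_homB rt) s2; have := ses_zdim rt s1.
have := relinj_zdim rt; have := ses_dim s1 => /=.
lia.
Qed.

Lemma hhdim0 (M I N : bimod) (i : 'Hom(M, I)) (p : 'Hom(I, N)) n :
  relinj I -> ses i p -> (zdim N + zdim M = n + zdim I)%N -> hhdim 0 M n.
Proof. by move=> rI s; have := ses_zdim rI s; rewrite /hhdim /=; lia. Qed.

Section Coresolution.
Variables (I : nat -> bimod) (D : forall k, 'Hom(I k, I k.+1)).
Hypotheses (bD : forall k, bmor (D k)) (rI : forall k, relinj (I k)).
Hypothesis exD : forall k, limg (D k) = lker (D k.+1).

Definition zker k := \dim (center (I k) :&: lker (D k)).

Lemma zdim_kerB k : zdim (kerB (bD k)) = zker k.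
Proof.
have [s kE] := kerB_ses (bD k.+1) (bmor_kerB_incl (bD k)) (bD k)
  (kerB_incl0 (bD k)) (limg_kerB_incl (bD k)) (exD k).
by rewrite (ses_zdim_ker s) kE.
Qed.

(** A is embedded in I_k for arbitrary k so that the induction on t can continue with A replaced by
    the kernel of D_(k+1) inside I_(k+1). *)
Lemma hhdim_coresolution t k (A : bimod) (i : 'Hom(A, I k)) n :
  bmor i -> lker i = 0%VS -> limg i = lker (D k) ->
  (zker (t + k).+1 + zker (t + k) = n + zdim (I (t + k)))%N -> hhdim t A n.
Proof.
move=> bi i0 ik; elim: t => [|t IH] in k A i bi i0 ik *.
  have [s kE] := kerB_ses (bD k.+1) bi (bD k) i0 ik (exD k).
  rewrite add0n -zdim_kerB => h; apply: (hhdim0 (rI k) s).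
  by rewrite (ses_zdim_ker s) kE.
have [s kE] := kerB_ses (bD k.+1) bi (bD k) i0 ik (exD k).
rewrite addSnnS => h; apply: (hhdim_shift (rI k) s).
apply: IH h; first exact: (bmor_kerB_incl (bD k.+1)).
  exact: kerB_incl0.
exact: limg_kerB_incl.
Qed.

Lemma zdim_coresolution (A : bimod) (i : 'Hom(A, I 0)) :
  bmor i -> lker i = 0%VS -> limg i = lker (D 0) -> zdim A = zker 0.
Proof.
move=> bi i0 ik.
have [s kE] := kerB_ses (bD 1) bi (bD 0) i0 ik (exD 0).
by rewrite (ses_zdim_ker s) kE.
Qed.
End Coresolution.

End Bimodules.

(** * Hochschild cochains by iterated currying *)

Section Currying.
Variables (K : fieldType) (d : nat) (mul : 'I_d -> 'I_d -> 'rV[K]_d).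
Hypothesis mulA : forall a b c l,
  \sum_k mul a b 0 k * mul k c 0 l = \sum_k mul b c 0 k * mul a k 0 l.
Local Notation bimod := (bimod mul).
Local Notation homB := (homB mulA).

(** Coefficients in an arbitrary bimodule are needed because each currying step replaces M by
    [homB M]. *)
Definition mcochain (M : bimod) t := {ffun {ffun 'I_t -> 'I_d} -> M}.

Definition mdiff (M : bimod) t (f : mcochain M t) : mcochain M t.+1 :=
  [ffun x : {ffun 'I_t.+1 -> 'I_d} =>
     lact M (x ord0) (f (drop_first x))
   + \sum_(i < t) ((-1) ^+ i.+1 *:
        \sum_(k < d) (mul (x (inord i)) (x (inord i.+1)) 0 k *: f (merge_at x i k)))
   + (-1) ^+ t.+1 *: ract M (x ord_max) (f (drop_last x))].

Lemma scalerC (V : lmodType K) (a b : K) (v : V) : a *: (b *: v) = b *: (a *: v).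
Proof. by rewrite !scalerA mulrC. Qed.

Lemma mdiff_linear (M : bimod) t : linear (@mdiff M t).
Proof.
move=> c f g; apply/ffunP => x; rewrite !ffunE.
rewrite [lact M _ _]linearP [ract M _ _]linearP /=.
under eq_bigr => i _ do
  (under eq_bigr => k _ do rewrite !ffunE scalerDr scalerC;
   rewrite big_split -scaler_sumr scalerDr scalerC).
rewrite big_split -scaler_sumr /= scalerDr [_ *: (c *: _)]scalerC.
by rewrite [in RHS]scalerDr [in RHS]scalerDr [RHS]addrACA [X in _ = X + _]addrACA.
Qed.

(** Appends a as last argument: the index t is not in 'I_t, so [insub] fails exactly there and
    [oapp] returns its default a. *)
Definition frcons t (x : {ffun 'I_t -> 'I_d}) (a : 'I_d) : {ffun 'I_t.+1 -> 'I_d} :=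
  [ffun j : 'I_t.+1 => oapp x a (insub (val j))].

Lemma frconsE t (x : {ffun 'I_t.+1 -> 'I_d}) a (j : nat) :
  (j < t.+2)%N ->
  frcons x a (inord j) = if (j < t.+1)%N then x (inord j) else a.
Proof.
move=> jt; rewrite ffunE /= inordK //; case: insubP => [u _ uE|].
  by rewrite -uE ltn_ord inord_val.
by move=> /negbTE ->.
Qed.

Lemma frconsK t (x : {ffun 'I_t -> 'I_d}) a : drop_last (frcons x a) = x.
Proof.
apply/ffunP => j; rewrite !ffunE /= inordK; last exact: ltnW (ltn_ord j).
by rewrite valK.
Qed.

Lemma frcons_max t (x : {ffun 'I_t -> 'I_d}) a : frcons x a ord_max = a.
Proof. by rewrite ffunE insubF ?ltnn. Qed.

Lemma frcons_drop t (x : {ffun 'I_t.+1 -> 'I_d}) :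
  frcons (drop_last x) (x ord_max) = x.
Proof.
apply/ffunP => j; rewrite ffunE; case: insubP => [u _ uE|ju] /=.
  by rewrite ffunE uE inord_val.
by congr (x _); apply: val_inj; move: ju (ltn_ord j) => /=; lia.
Qed.

Definition curry (M : bimod) t (f : mcochain M t.+1) : mcochain (homB M) t :=
  [ffun x => [ffun a => f (frcons x a)]].

Lemma curryE (M : bimod) t (f : mcochain M t.+1) x a :
  (curry f x : {ffun 'I_d -> M}) a = f (frcons x a).
Proof. by rewrite !ffunE. Qed.

Lemma curry_linear (M : bimod) t : linear (@curry M t).
Proof. by move=> c f g; apply/ffunP => x; apply/ffunP => a; rewrite !ffunE. Qed.

Lemma frcons0 t (x : {ffun 'I_t.+1 -> 'I_d}) a : frcons x a ord0 = x ord0.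
Proof.
have -> : ord0 = inord 0 :> 'I_t.+2 by apply: val_inj; rewrite /= inordK.
by rewrite frconsE //=; congr (x _); apply: val_inj; rewrite /= inordK.
Qed.

Lemma drop_first_frcons t (x : {ffun 'I_t.+1 -> 'I_d}) a :
  drop_first (frcons x a) = frcons (drop_first x) a.
Proof.
apply/ffunP => j; rewrite ffunE frconsE; last by rewrite ltnS ltn_ord.
rewrite ltnS [RHS]ffunE; case: insubP => [u ut uE|/negbTE ->] //=.
by rewrite ut -uE ffunE.
Qed.

Lemma merge_at_frcons t (x : {ffun 'I_t.+1 -> 'I_d}) a i k : (i < t)%N ->
  merge_at (frcons x a) i k = frcons (merge_at x i k) a.
Proof.
move=> it; apply/ffunP => j; have jt := ltn_ord j.
rewrite ffunE !frconsE ?ltnS //; last exact: ltnW.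
rewrite [RHS]ffunE; case: insubP => [u ut uE|/negbTE ut] /=.
  by rewrite ffunE -uE (ltn_ord u) (ltnW (ltn_ord u)).
move: ut => /= ut; rewrite ut; case: ltnP => ji.
  by rewrite (ltn_trans ji it) in ut.
by case: eqP => // ji'; rewrite ji' it in ut.
Qed.

Lemma merge_at_frcons_last t (x : {ffun 'I_t.+1 -> 'I_d}) a k :
  merge_at (frcons x a) t k = frcons (drop_last x) k.
Proof.
apply/ffunP => j; have jt := ltn_ord j.
rewrite ffunE frconsE; last exact: ltnW.
rewrite [RHS]ffunE jt; case: insubP => [u ut uE|/negbTE ut] /=.
  by rewrite ut ffunE -uE.
by rewrite ut ifT //; move: ut jt => /=; lia.
Qed.

(** The right action on [homB M] has two terms, so the last face of the curried cochain yields two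
    faces: g(ax) multiplies the last two arguments, and -g(a)x is the right action, now with sign
    (-1)^(t+2). *)
Lemma mdiff_curry (M : bimod) t (f : mcochain M t.+1) :
  mdiff (curry f) = curry (mdiff f).
Proof.
apply/ffunP => x; apply/ffunP => a.
have appE (u v w : homB M) (e : K) : (u + v + e *: w) a = u a + v a + e *: w a.
  by rewrite !ffunE.
rewrite curryE ffunE appE ffunE hom_lactE hom_ractE sum_ffunE ffunE.
rewrite [RHS]ffunE frcons0 drop_first_frcons frcons_max frconsK.
rewrite big_ord_recr /= scalerBr addrA addrA; congr (_ + _ + _ + _).
- apply: eq_bigr => i _; rewrite ffunE sum_ffunE; congr (_ *: _).
  apply: eq_bigr => k _; rewrite ffunE curryE -(merge_at_frcons _ _ _ (ltn_ord i)).
  have it := ltn_ord i; rewrite !frconsE ?ltnS ?(ltnW it) //; last exact/leqW/ltnW.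
  by rewrite it.
- congr (_ *: _); apply: eq_bigr => k _; rewrite curryE -(merge_at_frcons_last x a).
  rewrite !frconsE ?ltnS ?ltnn ?leqnn //; congr (mul (x _) _ 0 _ *: _).
  by apply: val_inj; rewrite /= inordK.
- by rewrite curryE frcons_drop -scaleNr [in RHS]exprS mulN1r.
Qed.

Definition uncurry (M : bimod) t (g : mcochain (homB M) t) : mcochain M t.+1 :=
  [ffun x => (g (drop_last x) : {ffun 'I_d -> M}) (x ord_max)].

Lemma uncurryK (M : bimod) t : cancel (@uncurry M t) (@curry M t).
Proof.
move=> g; apply/ffunP => x; apply/ffunP => a.
by rewrite curryE ffunE frconsK frcons_max.
Qed.

Lemma curryK (M : bimod) t : cancel (@curry M t) (@uncurry M t).
Proof. by move=> f; apply/ffunP => x; rewrite ffunE curryE frcons_drop. Qed.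

Lemma dim_curry (M : bimod) t (U : {vspace mcochain M t.+1})
    (W : {vspace mcochain (homB M) t}) :
  (forall f, (f \in U) = (curry f \in W)) -> \dim U = \dim W.
Proof.
move=> UW; have cE := linfunE (@curry_linear M t).
have c0 : lker (linfun (@curry M t)) = 0%VS.
  apply/eqP; rewrite -subv0; apply/subvP => f; rewrite memv_ker memv0 cE => /eqP f0.
  have z0 : curry 0 = 0 :> mcochain (homB M) t by rewrite -cE linear0.
  by rewrite -(curryK f) f0 -z0 curryK.
rewrite -(dim_img_inj U c0); congr (\dim _); apply/vspaceP => g.
apply/memv_imgP/idP => [[f fU ->]|gW]; first by rewrite cE -UW.
by exists (uncurry g); rewrite ?UW ?cE uncurryK.
Qed.

(** A 0-cochain is its value at the empty tuple, and it is a cocycle exactly if that value is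
    central. Each further argument is curried away, which is why M varies in the induction. *)
Lemma dim_ker_mdiff t (M : bimod) :
  \dim (lker (linfun (@mdiff M t))) = zdim mulA (homn mulA t M).
Proof.
elim: t M => [|t IH] M.
  pose x0 : {ffun 'I_0 -> 'I_d} := ffun0 (card_ord 0).
  pose ev (f : mcochain M 0) := f x0.
  have evE : forall f, linfun ev f = f x0.
    by apply: linfunE => c f g; rewrite /ev !ffunE.
  have x0E (x : {ffun 'I_0 -> 'I_d}) : x = x0 by apply/ffunP => -[].
  have ev0 : lker (linfun ev) = 0%VS.
    apply/eqP; rewrite -subv0; apply/subvP => f; rewrite memv_ker memv0 evE => /eqP f0.
    by apply/eqP/ffunP => x; rewrite (x0E x) f0 ffunE.
  rewrite -(dim_img_inj _ ev0); congr (\dim _); apply/vspaceP => v.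
  have dE (f : mcochain M 0) x :
      mdiff f x = lact M (x ord0) (f x0) - ract M (x ord0) (f x0).
    rewrite ffunE big_ord0 addr0 expr1 scaleN1r !(x0E (drop_first _), x0E (drop_last _)).
    by congr (_ - ract M (x _) _); apply: val_inj.
  apply/memv_imgP/centerP => [[f fK ->] a|vC].
    move: fK; rewrite memv_ker linfunE; last exact: mdiff_linear.
    move=> /eqP/ffunP/(_ [ffun=> a]); rewrite dE evE !ffunE => /eqP.
    by rewrite subr_eq0 => /eqP.
  exists [ffun=> v]; last by rewrite evE ffunE.
  rewrite memv_ker linfunE; last exact: mdiff_linear.
  by apply/eqP/ffunP => x; rewrite dE !ffunE vC subrr.
rewrite /homn iterSr -[iter t _ _]/(homn mulA t (homB M)) -IH.
apply: dim_curry => f; rewrite !memv_ker !linfunE; try exact: mdiff_linear.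
rewrite mdiff_curry -(inj_eq (can_inj (@curryK M t.+1))).
by congr (_ == _); apply/ffunP => x; apply/ffunP => a; rewrite !ffunE.
Qed.

Lemma dim_mcochain t (M : bimod) :
  \dim {:mcochain M t} = \dim {:homn mulA t M}.
Proof.
elim: t M => [|t IH] M.
  by rewrite !dimvf /dim /= !card_ffun !card_ord; apply: mul1n.
rewrite /homn iterSr -[iter t _ _]/(homn mulA t (homB M)) -IH.
by apply: dim_curry => f; rewrite !memvf.
Qed.

(** * The regular bimodule *)

Definition reg_lact (k : 'I_d) : 'End('rV[K]_d) := linfun (lmulb mul k).
Definition reg_ract (k : 'I_d) : 'End('rV[K]_d) := linfun (fun v => rmulb mul v k).

Lemma reg_lactE k v : reg_lact k v = lmulb mul k v.
Proof.
rewrite linfunE // => c u w; rewrite /lmulb scaler_sumr -big_split /=.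
by apply: eq_bigr => j _; rewrite !mxE scalerA scalerDl.
Qed.

Lemma reg_ractE k v : reg_ract k v = rmulb mul v k.
Proof.
rewrite linfunE // => c u w; rewrite /rmulb scaler_sumr -big_split /=.
by apply: eq_bigr => j _; rewrite !mxE scalerA scalerDl.
Qed.

Lemma reg_lact_coef k v l : reg_lact k v 0 l = \sum_j v 0 j * mul k j 0 l.
Proof. by rewrite reg_lactE summxE; apply: eq_bigr => j _; rewrite mxE. Qed.

Lemma reg_ract_coef k v l : reg_ract k v 0 l = \sum_j v 0 j * mul j k 0 l.
Proof. by rewrite reg_ractE summxE; apply: eq_bigr => j _; rewrite mxE. Qed.

Lemma reg_sum (v : 'rV[K]_d) (F : 'I_d -> 'I_d -> K) (G : 'I_d -> K) :
  \sum_k (\sum_j v 0 j * F j k) * G k = \sum_j v 0 j * (\sum_k F j k * G k).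
Proof.
under eq_bigr => k _ do rewrite mulr_suml.
rewrite exchange_big; apply: eq_bigr => j _; rewrite mulr_sumr.
by apply: eq_bigr => k _; rewrite mulrA.
Qed.

Lemma reg_lactA a b v :
  reg_lact a (reg_lact b v) = \sum_k mul a b 0 k *: reg_lact k v.
Proof.
apply/rowP => l; rewrite reg_lact_coef summxE.
under eq_bigr => k _ do rewrite reg_lact_coef.
under [RHS]eq_bigr => k _ do rewrite mxE reg_lact_coef mulr_sumr.
rewrite reg_sum [RHS]exchange_big; apply: eq_bigr => j _ /=.
by rewrite -mulA mulr_sumr; apply: eq_bigr => k _; rewrite mulrCA.
Qed.

Lemma reg_ractA a b v :
  reg_ract b (reg_ract a v) = \sum_k mul a b 0 k *: reg_ract k v.
Proof.
apply/rowP => l; rewrite reg_ract_coef summxE.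
under eq_bigr => k _ do rewrite reg_ract_coef.
under [RHS]eq_bigr => k _ do rewrite mxE reg_ract_coef mulr_sumr.
rewrite reg_sum [RHS]exchange_big; apply: eq_bigr => j _ /=.
by rewrite mulA mulr_sumr; apply: eq_bigr => k _; rewrite mulrCA.
Qed.

Lemma reg_lractC a b v : reg_lact a (reg_ract b v) = reg_ract b (reg_lact a v).
Proof.
apply/rowP => l; rewrite reg_lact_coef reg_ract_coef.
under eq_bigr => k _ do rewrite reg_ract_coef.
under [RHS]eq_bigr => k _ do rewrite reg_lact_coef.
by rewrite !reg_sum; apply: eq_bigr => j _; rewrite mulA.
Qed.

Definition regB : bimod := Bimod reg_lactA reg_ractA reg_lractC.

Lemma hdiff_mdiff t : linfun (@hdiff _ _ mul t) = linfun (@mdiff regB t).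
Proof.
have hE : @hdiff _ _ mul t =1 @mdiff regB t.
  by move=> f; apply/ffunP => x; rewrite !ffunE reg_lactE reg_ractE.
apply/lfunP => f; rewrite (linfunE (@mdiff_linear regB t)) -hE.
by apply: linfunE => c u w; rewrite !hE mdiff_linear.
Qed.

Lemma dim_ker_hdiff t :
  \dim (lker (linfun (@hdiff _ _ mul t))) = zdim mulA (homn mulA t regB).
Proof. by rewrite hdiff_mdiff; exact: (dim_ker_mdiff t regB). Qed.

Lemma HHdim0_zdim : HHdim mul 0 = zdim mulA regB.
Proof. by rewrite /HHdim subn0 dim_ker_hdiff. Qed.

(** Rank and nullity turn the dimension of the image of d_t into dim C^t minus the dimension of its
    kernel, matching the subtraction-free form of [hhdim]. *)
Lemma HHdimS_hhdim t n : hhdim mulA t regB n -> HHdim mul t.+1 = n.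
Proof.
rewrite /hhdim /HHdim dim_ker_hdiff.
have := limg_ker_dim (linfun (@hdiff _ _ mul t)) fullv.
have := dim_mcochain t regB; rewrite capfv dim_ker_hdiff /mcochain /cochain.
by move=> -> <-; lia.
Qed.
End Currying.

(** * The periodic resolution *)

(** Mirrors [mulR] on indices, without reference to K, so that products can be evaluated. *)
Definition bmul_spec (i j : nat) : nat :=
  let bi := nth (0%N, [::]) Rbasis i in
  let bj := nth (0%N, [::]) Rbasis j in
  if ptgt bj == bi.1 then
    if normalize (bj.1, bj.2 ++ bi.2) is Some q then
      (if q \in Rbasis then index q Rbasis else 34)%N
    else 34%N
  else 34%N.

(** Tabulated once, because the checks below look up very many products; associativity alone ranges
    over 34^3 triples. *)
Definition bmul_table : seq (seq nat) :=
  Eval vm_compute in mkseq (fun i => mkseq (bmul_spec i) 34) 34.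

(* The basis elements of R are numbered as in [Rbasis], and 34 stands for 0: the
   product of two basis elements is a basis element or 0. *)
Definition bm (i j : nat) : nat := nth 34%N (nth [::] bmul_table i) j.

(* (c, (s, x, y)) stands for (-1)^c x (x) y in the summand number s. *)
Definition term := (bool * (nat * nat * nat))%type.
Local Notation P s x y := (false, (s, x, y)) (only parsing).
Local Notation N s x y := (true, (s, x, y)) (only parsing).

(* Q_k is the sum of the e_i R (x) R e_j over the pairs (i, j) of the k-th list
   (idempotents, as basis elements).  The Q_k form the minimal projective bimodule
   resolution of the dual of R, which satisfies Q_(k+22) = Q_k. *)
Definition summands_data : seq (seq (nat * nat)) :=
[:: [:: (0, 0); (24, 7); (29, 12); (17, 17); (7, 24); (12, 29)]; [:: (17, 0);
(0, 7); (24, 12); (12, 17); (29, 17); (0, 24); (7, 29)]; [:: (29, 7); (0, 17);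
(12, 24); (17, 0); (7, 12); (24, 29)]; [:: (12, 0); (29, 0); (17, 7); (0, 12);
(7, 17); (24, 17); (17, 24); (0, 29)]; [:: (29, 7); (0, 17); (12, 24); (0, 0);
(7, 7); (12, 12); (17, 17); (24, 24); (29, 29)]; [:: (0, 7); (12, 17);
(29, 17); (0, 24); (7, 0); (24, 0); (17, 12); (17, 29)]; [:: (0, 0); (7, 7);
(12, 12); (17, 17); (24, 24); (29, 29); (17, 0); (24, 12); (7, 29)];
[:: (12, 0); (29, 0); (17, 7); (0, 12); (7, 17); (24, 17); (17, 24); (0, 29)];
[:: (12, 7); (0, 17); (29, 24); (17, 0); (24, 12); (7, 29)]; [:: (7, 0);
(24, 0); (29, 7); (17, 12); (0, 17); (12, 24); (17, 29)]; [:: (0, 0); (24, 7);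
(29, 12); (17, 17); (7, 24); (12, 29)]; [:: (0, 0); (7, 7); (12, 12);
(17, 17); (24, 24); (29, 29)]; [:: (17, 0); (0, 7); (7, 12); (12, 17);
(29, 17); (0, 24); (24, 29)]; [:: (12, 7); (0, 17); (29, 24); (17, 0);
(24, 12); (7, 29)]; [:: (12, 0); (29, 0); (17, 7); (0, 12); (7, 17); (24, 17);
(17, 24); (0, 29)]; [:: (12, 7); (0, 17); (29, 24); (0, 0); (24, 7); (29, 12);
(17, 17); (7, 24); (12, 29)]; [:: (0, 7); (12, 17); (29, 17); (0, 24); (7, 0);
(24, 0); (17, 12); (17, 29)]; [:: (0, 0); (24, 7); (29, 12); (17, 17);
(7, 24); (12, 29); (17, 0); (7, 12); (24, 29)]; [:: (12, 0); (29, 0); (17, 7);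
(0, 12); (7, 17); (24, 17); (17, 24); (0, 29)]; [:: (29, 7); (0, 17);
(12, 24); (17, 0); (7, 12); (24, 29)]; [:: (7, 0); (24, 0); (12, 7); (17, 12);
(0, 17); (29, 24); (17, 29)]; [:: (0, 0); (7, 7); (12, 12); (17, 17);
(24, 24); (29, 29)]]%N.

(* A term (s', u, v) of the s-th list of the k-th entry contributes
   x (x) y |-> ux (x) yv from the summand s of Q_(k+1) to the summand s' of Q_k. *)
Definition diff_data : seq (seq (seq term)) :=
[:: [:: [:: N 0 18 0; P 3 17 18]; [:: N 0 0 1; P 1 2 7]; [:: N 1 24 8;
P 2 25 12]; [:: N 3 13 17; P 5 12 30]; [:: N 2 29 13; P 3 30 17]; [:: N 0 0 2;
P 4 1 24]; [:: N 4 7 25; P 5 8 29]];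
    [:: [:: N 0 30 1; P 1 31 7; P 4 29 19]; [:: N 1 0 9; N 2 2 13; N 3 3 17;
N 4 4 17; P 5 0 26; P 6 1 30]; [:: N 0 13 2; N 3 12 20; P 5 14 24];
[:: N 0 23 0; N 0 17 6; P 1 18 10; P 2 20 14; P 4 22 18]; [:: N 0 9 3;
P 1 10 8; P 2 11 12; N 3 8 21; P 6 7 33]; [:: N 0 26 4; P 2 24 16; P 4 25 22;
P 5 27 25; P 6 28 29]];
    [:: [:: P 1 14 18; N 2 12 27; P 3 13 0]; [:: N 0 29 10; P 3 30 0];
[:: N 0 22 7; P 3 17 1]; [:: N 0 4 8; N 1 0 21; P 4 1 12]; [:: P 1 10 17;
N 2 8 26; P 4 7 13]; [:: N 0 25 9; N 1 27 17; P 5 24 30]; [:: P 1 18 20;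
N 2 21 24; P 3 17 2]; [:: P 1 0 22; N 2 3 25; P 5 2 29]];
    [:: [:: N 1 29 1; P 2 30 7]; [:: P 3 0 13; N 4 1 17; N 5 2 17; P 7 0 30];
[:: N 0 12 2; P 6 13 24]; [:: N 0 3 0; P 1 4 0; N 3 0 14; P 4 1 18];
[:: N 0 8 1; P 2 9 7; P 4 7 19]; [:: P 0 12 3; N 2 13 8; P 3 14 12];
[:: N 2 17 9; P 3 18 13; N 4 19 17; P 6 17 26]; [:: N 1 25 2; P 5 24 20;
P 6 26 24]; [:: P 1 29 4; N 6 30 25; P 7 31 29]];
    [:: [:: N 0 4 7; N 3 0 1; P 4 1 7]; [:: N 2 12 26; N 5 12 13; P 6 13 17];
[:: P 0 29 9; N 1 31 17; P 6 30 17; P 8 29 30]; [:: P 1 0 20; N 2 3 24;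
P 3 0 2; P 7 2 24]; [:: P 3 10 0; P 4 7 10; P 5 8 14]; [:: N 0 25 10;
N 3 27 0; N 6 26 18; P 7 24 27]; [:: P 0 22 8; P 3 18 3; P 5 21 12;
P 6 17 21]; [:: P 2 21 25; N 3 18 4; N 6 17 22; P 8 22 29]];
    [:: [:: N 0 0 10; P 1 3 18; N 3 0 27; P 4 1 0; P 5 2 0]; [:: P 0 10 7;
P 4 7 1]; [:: P 0 14 8; N 1 12 21; P 6 13 12]; [:: P 1 21 17; N 2 22 17;
P 6 17 13; P 7 17 30]; [:: P 2 25 20; P 3 27 24; P 5 24 2]; [:: P 2 29 22;
P 3 31 25; P 7 30 29]; [:: P 0 18 10; N 4 19 0; P 6 17 14]; [:: P 5 24 3;
P 6 26 12]; [:: P 1 8 22; P 4 7 4; P 7 9 29]];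
    [:: [:: N 2 12 14; P 6 13 0]; [:: P 0 31 0; N 3 30 18; P 5 29 31;
P 6 30 0]; [:: P 1 19 7; P 6 17 1]; [:: N 0 0 3; P 1 1 8; N 2 3 12; P 7 2 12];
[:: N 1 7 9; P 2 8 13; N 3 9 17; P 8 7 30]; [:: N 3 26 17; N 4 24 26;
P 5 25 30; P 7 24 13]; [:: P 0 18 2; N 3 17 20; N 4 20 24; P 6 17 2];
[:: N 0 0 4; P 4 2 25; N 5 4 29; P 8 1 29]];
    [:: [:: N 0 12 1; P 2 13 7]; [:: N 3 0 13; N 4 1 17; P 5 2 17; P 7 0 30];
[:: N 1 29 2; P 6 30 24]; [:: N 0 21 0; P 1 22 0; N 2 17 10; P 3 18 14;
N 5 20 18; P 6 17 27]; [:: N 1 25 3; P 2 26 8; N 3 27 12; P 5 24 21];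
[:: N 0 8 4; N 4 7 22; P 6 9 25; P 7 10 29]];
    [:: [:: N 0 8 10; N 1 10 18; N 3 9 0; P 5 7 31]; [:: N 2 25 27; P 3 26 0;
P 4 24 14]; [:: N 0 33 7; N 2 29 28; P 3 30 1]; [:: N 0 21 8; P 3 17 3;
P 4 20 12]; [:: N 0 3 9; N 1 6 17; N 1 0 23; N 2 4 26; P 4 2 13; P 5 1 30];
[:: P 0 12 11; P 1 14 20; P 2 16 24; P 3 13 2]; [:: N 1 18 22; N 2 22 25;
N 3 17 4; P 5 19 29]];
    [:: [:: N 0 1 0; N 1 2 0; P 4 0 18]; [:: N 1 24 1; P 2 25 7];
[:: N 2 29 8; P 3 30 12]; [:: P 3 17 13; N 4 18 17; P 6 17 30]; [:: P 0 7 2;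
P 5 8 24]; [:: P 5 12 25; P 6 13 29]];
    [:: [:: N 0 6 0; N 0 0 6; P 1 2 10; P 2 4 14; N 3 5 18; N 4 1 27;
P 5 3 31]; [:: N 0 10 1; P 1 11 7; N 3 9 19; N 4 7 28; P 5 8 32];
[:: N 0 14 3; P 1 15 8; P 2 16 12; N 3 13 21; P 5 12 33]; [:: N 0 18 5;
P 1 20 9; P 2 22 13; N 3 23 17; N 3 17 23; N 4 19 26; P 5 21 30];
[:: P 0 27 2; N 1 24 11; N 2 25 15; P 3 26 20; P 4 28 24]; [:: N 0 31 4;
P 2 29 16; N 3 30 22; N 4 32 25; P 5 33 29]];
    [:: [:: N 0 18 0; P 3 17 18]; [:: N 0 0 1; P 1 1 7]; [:: N 1 7 8;
P 2 8 12]; [:: N 2 12 13; P 3 13 17]; [:: N 3 30 17; P 5 29 30]; [:: P 0 0 2;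
P 4 2 24]; [:: P 4 24 25; P 5 25 29]];
    [:: [:: N 0 13 1; P 1 14 7; P 3 12 19]; [:: N 1 0 9; N 2 1 13; N 3 3 17;
N 4 4 17; N 5 0 26; P 6 2 30]; [:: P 0 30 2; P 4 29 20; P 5 31 24];
[:: N 0 23 0; N 0 17 6; P 1 18 10; P 2 19 14; P 3 21 18]; [:: N 0 26 3;
P 1 27 8; P 2 28 12; N 4 25 21; P 6 24 33]; [:: N 0 9 4; P 2 7 16; P 3 8 22;
N 5 10 25; P 6 11 29]];
    [:: [:: N 0 12 10; P 3 13 0]; [:: P 1 31 18; P 2 29 27; P 3 30 0];
[:: N 0 21 7; P 3 17 1]; [:: N 0 3 8; N 1 0 21; P 4 2 12]; [:: N 0 8 9;
N 1 10 17; P 5 7 30]; [:: P 1 27 17; P 2 25 26; P 4 24 13]; [:: P 1 18 20;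
P 2 22 24; P 3 17 2]; [:: P 1 0 22; P 2 4 25; P 5 1 29]];
    [:: [:: N 0 12 1; P 2 13 7]; [:: P 3 0 13; N 4 1 17; N 5 2 17; P 7 0 30];
[:: N 1 29 2; P 6 30 24]; [:: P 0 3 0; N 1 4 0; N 3 0 14; P 5 2 18];
[:: N 1 25 1; P 2 26 7; P 5 24 19]; [:: P 1 29 3; N 2 30 8; P 3 31 12];
[:: N 2 17 9; P 3 18 13; N 5 20 17; P 6 17 26]; [:: N 0 8 2; P 4 7 20;
P 6 9 24]; [:: P 0 12 4; N 6 13 25; P 7 14 29]];
    [:: [:: N 0 3 7; N 3 0 1; P 4 2 7]; [:: P 0 12 9; N 1 14 17; P 6 13 17;
P 8 12 30]; [:: N 2 29 26; N 5 29 13; P 6 30 17]; [:: P 1 0 20; N 2 4 24;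
P 3 0 2; P 7 1 24]; [:: N 0 8 10; N 3 10 0; N 6 9 18; P 7 7 27]; [:: P 3 27 0;
P 4 24 10; P 5 25 14]; [:: P 0 21 8; P 3 18 3; P 5 22 12; P 6 17 21];
[:: P 2 22 25; N 3 18 4; N 6 17 22; P 8 21 29]];
    [:: [:: N 0 0 10; P 2 4 18; N 3 0 27; P 4 1 0; P 5 2 0]; [:: P 0 27 7;
P 5 24 1]; [:: P 0 31 8; N 2 29 21; P 6 30 12]; [:: N 1 21 17; P 2 22 17;
P 6 17 13; P 7 17 30]; [:: P 1 8 20; P 3 10 24; P 4 7 2]; [:: P 1 12 22;
P 3 14 25; P 7 13 29]; [:: P 2 22 18; N 3 18 27; P 4 19 0; P 6 17 14];
[:: P 4 7 3; P 6 9 12]; [:: P 2 25 22; P 5 24 4; P 7 26 29]];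
    [:: [:: N 3 13 18; P 5 12 31; P 6 13 0]; [:: N 0 31 0; N 2 29 14;
P 6 30 0]; [:: N 0 18 1; P 1 20 7; P 6 17 1]; [:: N 0 0 3; P 1 2 8; N 2 4 12;
P 7 1 12]; [:: N 3 9 17; N 4 7 26; P 5 8 30; P 7 7 13]; [:: N 1 24 9;
P 2 25 13; N 3 26 17; P 8 24 30]; [:: N 3 17 20; N 4 19 24; P 6 17 2];
[:: N 0 0 4; P 4 1 25; N 5 3 29; P 8 2 29]];
    [:: [:: N 1 29 1; P 2 30 7]; [:: N 3 0 13; P 4 1 17; N 5 2 17; P 7 0 30];
[:: N 0 12 2; P 6 13 24]; [:: P 0 21 0; N 1 22 0; N 2 17 10; P 3 18 14;
N 4 19 18; P 6 17 27]; [:: N 0 8 3; P 2 9 8; N 3 10 12; P 4 7 21];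
[:: N 1 25 4; N 5 24 22; P 6 26 25; P 7 27 29]];
    [:: [:: N 2 8 27; P 3 9 0; P 4 7 14]; [:: N 0 25 10; N 1 27 18; N 3 26 0;
P 5 24 31]; [:: N 0 16 7; N 2 12 28; P 3 13 1]; [:: N 0 22 8; P 3 17 3;
P 4 19 12]; [:: N 0 4 9; N 1 6 17; N 1 0 23; N 2 3 26; P 4 1 13; P 5 2 30];
[:: P 0 29 11; P 1 31 20; P 2 33 24; P 3 30 2]; [:: N 1 18 22; N 2 21 25;
N 3 17 4; P 5 20 29]];
    [:: [:: N 0 1 0; N 1 2 0; P 4 0 18]; [:: N 0 7 1; P 2 8 7]; [:: N 2 12 8;
P 3 13 12]; [:: P 3 17 13; N 4 18 17; P 6 17 30]; [:: P 1 24 2; P 5 25 24];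
[:: P 5 29 25; P 6 30 29]];
    [:: [:: N 0 6 0; N 0 0 6; P 1 1 10; P 2 3 14; N 3 5 18; N 4 2 27;
P 5 4 31]; [:: N 0 27 1; P 1 28 7; N 3 26 19; N 4 24 28; P 5 25 32];
[:: N 0 31 3; P 1 32 8; P 2 33 12; N 3 30 21; P 5 29 33]; [:: N 0 18 5;
P 1 19 9; P 2 21 13; N 3 23 17; N 3 17 23; N 4 20 26; P 5 22 30];
[:: N 0 10 2; P 1 7 11; P 2 8 15; N 3 9 20; N 4 11 24]; [:: N 0 14 4;
P 2 12 16; N 3 13 22; N 4 15 25; P 5 16 29]]]%N.

(* A contracting homotopy Q_k -> Q_(k+1), linear in y: in the summand s of Q_k it
   maps x (x) y to the sum of the x' (x) yv over the terms (s', x', v) attached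
   to x, and to 0 if x is not listed. *)
Definition htpy_data : seq (seq (seq (nat * seq term))) :=
[:: [:: [:: (6, [:: N 0 5 0; P 1 0 10; P 2 2 14; P 4 4 18]); (10, [:: N 0 9 0;
N 3 8 18; P 6 7 31]); (14, [:: N 0 13 0; N 3 12 18]); (18, [:: N 0 17 0]);
(27, [:: N 0 26 0; P 2 24 14; P 4 25 18]); (31, [:: N 0 30 0; P 4 29 18])];
[:: (2, [:: P 1 0 7]); (11, [:: N 0 9 1; P 1 10 7; N 3 8 19; P 6 7 32]); (15,
[:: N 0 13 1; P 1 14 7; N 3 12 19]); (20, [:: N 0 17 1; P 1 18 7])]; [:: (4,
[:: P 1 0 8; P 2 2 12]); (16, [:: N 0 13 3; P 1 14 8; P 2 15 12; N 3 12 21]);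
(22, [:: N 0 17 3; P 1 18 8; P 2 20 12]); (25, [:: P 2 24 12])]; [:: (5,
[:: P 1 0 9; P 2 2 13; P 4 4 17]); (9, [:: N 3 8 17; P 6 7 30]); (13,
[:: N 3 12 17]); (23, [:: N 0 17 5; P 1 18 9; P 2 20 13; P 4 22 17]); (26,
[:: P 2 24 13; P 4 25 17]); (30, [:: P 4 29 17])]; [:: (1, [:: P 5 0 24]);
(19, [:: N 0 17 2; P 5 18 24]); (28, [:: N 0 26 2; P 2 24 15; P 4 25 20;
P 5 27 24]); (32, [:: N 0 30 2; P 4 29 20; P 5 31 24])]; [:: (3, [:: P 5 0 25;
P 6 1 29]); (8, [:: P 6 7 29]); (21, [:: N 0 17 4; P 5 18 25; P 6 19 29]);
(33, [:: N 0 30 4; P 4 29 22; P 5 31 25; P 6 32 29])]];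
    [:: [:: (23, [:: N 3 17 0])]; [:: (6, [:: P 0 4 7]); (27, [:: P 0 25 7]);
(31, [:: P 0 29 7])]; [:: (11, [:: P 4 7 12])]; [:: (3, [:: N 1 0 17]); (21,
[:: N 1 18 17]); (33, [:: N 0 29 9; N 1 31 17])]; [:: (16, [:: N 1 14 17;
P 2 12 26])]; [:: (6, [:: N 1 0 20; P 2 3 24]); (10, [:: P 2 8 24]); (14,
[:: P 2 12 24])]; [:: (28, [:: P 5 24 29])]];
    [:: [:: (16, [:: P 0 12 1; N 2 13 7]); (22, [:: N 2 17 7])]; [:: (6,
[:: N 3 0 13; P 4 1 17]); (10, [:: P 4 7 17]); (27, [:: N 5 24 17])]; [:: (21,
[:: N 6 17 24]); (33, [:: P 1 29 2; N 6 30 24])]; [:: (5, [:: P 1 4 0]); (9,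
[:: P 0 8 0; N 4 7 18]); (13, [:: P 0 12 0]); (23, [:: P 1 22 0; N 2 17 10]);
(26, [:: P 1 25 0]); (30, [:: P 1 29 0])]; [:: (1, [:: P 3 0 12]); (19,
[:: N 2 17 8; P 3 18 12]); (28, [:: P 3 27 12; N 5 24 21]); (32,
[:: P 3 31 12])]; [:: (2, [:: P 7 0 29]); (11, [:: N 4 7 22; P 7 10 29]); (15,
[:: P 7 14 29]); (20, [:: N 6 17 25; P 7 18 29])]];
    [:: [:: (3, [:: N 3 0 0]); (21, [:: N 3 18 0; N 6 17 18]); (33,
[:: N 0 29 10; N 3 31 0; N 6 30 18])]; [:: (16, [:: P 3 14 0; P 5 12 14])];
[:: (5, [:: P 0 4 7]); (9, [:: P 4 7 7]); (23, [:: P 0 22 7]); (26,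
[:: P 0 25 7]); (30, [:: P 0 29 7])]; [:: (6, [:: P 4 1 8; P 5 3 12]); (10,
[:: P 4 7 8; P 5 8 12]); (14, [:: P 5 12 12])]; [:: (19, [:: N 6 17 17]); (28,
[:: N 0 25 9; N 6 26 17; P 7 24 26]); (32, [:: N 0 29 9; N 6 30 17])]; [:: (2,
[:: N 1 0 17]); (11, [:: N 1 10 17; P 4 7 9; P 5 8 13]); (15, [:: N 1 14 17;
P 5 12 13]); (20, [:: N 1 18 17; P 6 17 17])]; [:: (5, [:: P 2 3 24;
N 3 0 2]); (9, [:: P 2 8 24]); (13, [:: P 2 12 24]); (23, [:: P 2 21 24;
N 3 18 2; N 6 17 20]); (26, [:: P 7 24 24])]; [:: (6, [:: P 2 3 25; N 3 0 4;
P 8 4 29]); (27, [:: P 7 24 25; P 8 25 29]); (31, [:: P 8 29 29])]];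
    [:: [:: (16, [:: N 0 14 7])]; [:: (6, [:: N 0 0 9; P 1 3 17; N 2 4 17]);
(27, [:: N 2 25 17]); (31, [:: N 2 29 17])]; [:: (33, [:: N 2 29 20;
N 3 31 24])]; [:: (6, [:: P 4 1 0]); (10, [:: P 4 7 0]); (27, [:: N 5 24 0])];
[:: (1, [:: P 0 0 7]); (19, [:: P 0 18 7]); (28, [:: P 0 27 7; N 5 24 1]);
(32, [:: P 0 31 7])]; [:: (3, [:: N 0 0 8]); (21, [:: P 6 17 12]); (33,
[:: P 6 30 12])]; [:: (5, [:: N 0 0 9; P 1 3 17]); (9, [:: P 1 8 17]); (13,
[:: P 1 12 17]); (23, [:: P 1 21 17; P 6 17 13])]; [:: (2, [:: P 3 0 24]);
(11, [:: P 3 10 24; N 4 7 2]); (15, [:: P 3 14 24]); (20, [:: P 3 18 24])];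
[:: (16, [:: P 1 12 22; P 7 13 29]); (22, [:: P 7 17 29])]];
    [:: [:: (6, [:: P 1 1 7]); (10, [:: P 1 7 7])]; [:: (33, [:: P 3 30 17;
N 5 29 30])]; [:: (16, [:: P 2 12 13; N 3 13 17]); (22, [:: N 3 17 17])];
[:: (6, [:: N 0 0 2; P 4 2 24]); (27, [:: P 4 24 24])]; [:: (19,
[:: N 6 17 0]); (28, [:: P 0 27 0; P 4 24 27]); (32, [:: N 6 30 0])]; [:: (2,
[:: P 0 0 0]); (11, [:: P 0 10 0; P 1 7 10]); (15, [:: P 0 14 0]); (20,
[:: P 0 18 0; P 6 17 0])]; [:: (5, [:: N 1 1 8; P 2 3 12]); (9, [:: N 1 7 8;
P 2 8 12]); (13, [:: P 2 12 12]); (23, [:: P 2 21 12]); (26, [:: P 7 24 12])];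
[:: (5, [:: P 8 1 29]); (9, [:: P 8 7 29]); (23, [:: P 3 17 22; P 5 22 29]);
(26, [:: N 4 24 25; P 5 25 29]); (30, [:: P 5 29 29])]];
    [:: [:: (6, [:: N 0 3 0; P 1 4 0; P 3 0 14; N 5 2 18]); (31,
[:: P 1 29 0])]; [:: (19, [:: P 2 17 7]); (28, [:: N 1 25 1; P 2 26 7;
P 5 24 19]); (32, [:: P 2 30 7])]; [:: (33, [:: N 1 29 3; P 2 30 8;
N 3 31 12])]; [:: (5, [:: N 4 1 17]); (9, [:: N 4 7 17]); (23, [:: N 2 17 9;
P 3 18 13; N 5 20 17; P 6 17 26]); (26, [:: N 5 24 17])]; [:: (11,
[:: P 0 8 2; P 4 7 20; N 6 9 24]); (15, [:: P 0 12 2; N 6 13 24]); (20,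
[:: N 6 17 24])]; [:: (4, [:: N 7 0 29]); (16, [:: P 0 12 4; N 6 13 25;
N 7 14 29])]; [:: (5, [:: P 0 3 0]); (9, [:: P 0 8 0]); (13, [:: P 0 12 0]);
(23, [:: P 0 21 0]); (26, [:: P 1 25 0; N 5 24 18])]; [:: (2, [:: P 3 0 12]);
(11, [:: P 3 10 12]); (15, [:: P 3 14 12]); (20, [:: N 2 17 8; P 3 18 12])];
[:: (19, [:: P 6 17 25; P 7 18 29]); (28, [:: P 7 27 29]); (32, [:: P 1 29 4;
P 7 31 29])]];
    [:: [:: (33, [:: P 2 29 27; N 3 30 0])]; [:: (4, [:: P 1 0 18]); (16,
[:: P 0 12 10; P 1 14 18; P 3 13 0]); (22, [:: P 3 17 0])]; [:: (5,
[:: P 0 3 7]); (9, [:: P 0 8 7]); (13, [:: P 0 12 7]); (23, [:: P 0 21 7])];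
[:: (6, [:: P 0 3 8; N 4 2 12]); (27, [:: N 4 24 12])]; [:: (19,
[:: N 1 18 17]); (28, [:: N 1 27 17; P 4 24 13]); (32, [:: N 1 31 17])];
[:: (2, [:: P 1 0 17]); (11, [:: P 1 10 17; N 5 7 30]); (15, [:: P 1 14 17])];
[:: (5, [:: P 1 0 20; P 2 4 24]); (23, [:: P 2 22 24; P 3 17 2]); (26,
[:: P 2 25 24]); (30, [:: P 2 29 24])]; [:: (6, [:: N 1 0 22; N 2 4 25;
P 5 1 29]); (10, [:: P 5 7 29])]];
    [:: [:: (33, [:: N 2 29 7])]; [:: (6, [:: N 4 0 17])]; [:: (16,
[:: P 5 12 24])]; [:: (5, [:: P 1 2 0]); (9, [:: N 0 7 0]); (23, [:: P 1 20 0;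
N 3 17 14]); (26, [:: P 1 24 0])]; [:: (11, [:: P 0 7 3; P 3 9 12]); (15,
[:: P 3 13 12]); (20, [:: P 3 17 12])]; [:: (19, [:: P 6 17 29]); (28,
[:: P 1 24 4; P 6 26 29]); (32, [:: P 6 30 29])]];
    [:: [:: (1, [:: N 0 0 0]); (19, [:: N 0 18 0; N 3 17 18]); (28,
[:: N 0 27 0; P 1 24 10; P 2 25 14; N 3 26 18]); (32, [:: N 0 31 0; P 2 29 14;
N 3 30 18])]; [:: (11, [:: N 0 10 0; N 3 9 18; N 4 7 27; P 5 8 31]); (15,
[:: N 0 14 0; N 3 13 18; P 5 12 31])]; [:: (4, [:: P 1 2 7]); (16,
[:: N 0 14 1; P 1 15 7; N 3 13 19; P 5 12 32]); (22, [:: P 1 20 7]); (25,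
[:: P 1 24 7])]; [:: (5, [:: P 1 2 8; P 2 4 12]); (23, [:: P 1 20 8;
P 2 22 12]); (26, [:: P 1 24 8; P 2 25 12]); (30, [:: P 2 29 12])]; [:: (6,
[:: N 0 0 5; P 1 2 9; P 2 4 13; N 3 5 17; N 4 1 26; P 5 3 30]); (10,
[:: N 3 9 17; N 4 7 26; P 5 8 30]); (14, [:: N 3 13 17; P 5 12 30]); (18,
[:: N 3 17 17]); (27, [:: P 1 24 9; P 2 25 13; N 3 26 17]); (31,
[:: P 2 29 13; N 3 30 17])]; [:: (3, [:: P 0 0 2; P 4 1 24]); (8,
[:: P 4 7 24]); (21, [:: P 0 18 2; P 3 17 20; P 4 19 24]); (33, [:: P 0 31 2;
N 2 29 15; P 3 30 20; P 4 32 24])]; [:: (5, [:: N 0 0 4; N 4 1 25; P 5 3 29]);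
(9, [:: N 4 7 25; P 5 8 29]); (13, [:: P 5 12 29]); (23, [:: N 0 18 4;
N 3 17 22; N 4 19 25; P 5 21 29])]];
    [:: [:: (6, [:: N 0 0 0])]; [:: (11, [:: P 1 7 7])]; [:: (16,
[:: P 2 12 12])]; [:: (23, [:: N 3 17 17])]; [:: (28, [:: P 4 24 24])];
[:: (33, [:: P 5 29 29])]];
    [:: [:: (6, [:: N 0 5 0; P 1 0 10; P 2 1 14; P 3 3 18]); (10, [:: N 0 9 0;
P 2 7 14; P 3 8 18]); (14, [:: N 0 13 0; P 3 12 18]); (18, [:: N 0 17 0]);
(27, [:: N 0 26 0; N 4 25 18; P 6 24 31]); (31, [:: N 0 30 0; N 4 29 18])];
[:: (1, [:: P 1 0 7]); (19, [:: N 0 17 1; P 1 18 7]); (28, [:: N 0 26 1;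
P 1 27 7; N 4 25 19; P 6 24 32]); (32, [:: N 0 30 1; P 1 31 7; N 4 29 19])];
[:: (3, [:: P 1 0 8; P 2 1 12]); (8, [:: P 2 7 12]); (21, [:: N 0 17 3;
P 1 18 8; P 2 19 12]); (33, [:: N 0 30 3; P 1 31 8; P 2 32 12; N 4 29 21])];
[:: (5, [:: P 1 0 9; P 2 1 13; P 3 3 17]); (9, [:: P 2 7 13; P 3 8 17]); (13,
[:: P 3 12 17]); (23, [:: N 0 17 5; P 1 18 9; P 2 19 13; P 3 21 17]); (26,
[:: N 4 25 17; P 6 24 30]); (30, [:: N 4 29 17])]; [:: (2, [:: P 5 0 24]);
(11, [:: P 0 9 2; N 2 7 15; N 3 8 20; P 5 10 24]); (15, [:: P 0 13 2;
N 3 12 20; P 5 14 24]); (20, [:: P 0 17 2; P 5 18 24])]; [:: (4, [:: N 5 0 25;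
P 6 2 29]); (16, [:: N 0 13 4; P 3 12 22; N 5 14 25; P 6 15 29]); (22,
[:: N 0 17 4; N 5 18 25; P 6 20 29]); (25, [:: P 6 24 29])]];
    [:: [:: (23, [:: N 3 17 0])]; [:: (6, [:: P 0 3 7]); (10, [:: P 0 8 7]);
(14, [:: P 0 12 7])]; [:: (28, [:: P 4 24 12])]; [:: (33, [:: N 1 31 17;
N 2 29 26])]; [:: (4, [:: N 1 0 17]); (16, [:: N 0 12 9; N 1 14 17]); (22,
[:: N 1 18 17])]; [:: (6, [:: P 1 0 20; P 2 4 24]); (27, [:: P 2 25 24]); (31,
[:: P 2 29 24])]; [:: (11, [:: P 5 7 29])]];
    [:: [:: (21, [:: N 2 17 7]); (33, [:: P 1 29 1; N 2 30 7])]; [:: (6,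
[:: N 3 0 13; P 5 2 17]); (10, [:: N 4 7 17]); (27, [:: P 5 24 17])]; [:: (16,
[:: N 0 12 2; P 6 13 24]); (22, [:: P 6 17 24])]; [:: (5, [:: P 0 3 0]); (9,
[:: P 0 8 0]); (13, [:: P 0 12 0]); (23, [:: P 0 21 0; N 2 17 10]); (26,
[:: P 1 25 0; N 5 24 18]); (30, [:: P 1 29 0])]; [:: (2, [:: P 3 0 12]); (11,
[:: P 3 10 12; N 4 7 21]); (15, [:: P 3 14 12]); (20, [:: N 2 17 8;
P 3 18 12])]; [:: (1, [:: P 7 0 29]); (19, [:: N 6 17 25; P 7 18 29]); (28,
[:: N 5 24 22; P 7 27 29]); (32, [:: P 7 31 29])]];
    [:: [:: (33, [:: P 3 31 0; P 5 29 14])]; [:: (4, [:: N 3 0 0]); (16,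
[:: N 0 12 10; N 3 14 0; N 6 13 18]); (22, [:: N 3 18 0; N 6 17 18])]; [:: (5,
[:: P 0 3 7]); (9, [:: P 0 8 7]); (13, [:: P 0 12 7]); (23, [:: P 0 21 7]);
(26, [:: P 4 24 7])]; [:: (6, [:: P 4 2 8; P 5 4 12]); (27, [:: P 4 24 8;
P 5 25 12]); (31, [:: P 5 29 12])]; [:: (1, [:: N 1 0 17]); (19,
[:: N 1 18 17; P 6 17 17]); (28, [:: N 1 27 17; P 4 24 9; P 5 25 13]); (32,
[:: N 1 31 17; P 5 29 13])]; [:: (11, [:: N 0 8 9; N 6 9 17; P 7 7 26]); (15,
[:: N 0 12 9; N 6 13 17]); (20, [:: N 6 17 17])]; [:: (5, [:: P 2 4 24;
N 3 0 2]); (9, [:: P 7 7 24]); (23, [:: P 2 22 24; N 3 18 2; N 6 17 20]); (26,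
[:: P 2 25 24]); (30, [:: P 2 29 24])]; [:: (6, [:: P 2 4 25; N 3 0 4;
P 8 3 29]); (10, [:: P 7 7 25; P 8 8 29]); (14, [:: P 8 12 29])]];
    [:: [:: (33, [:: N 0 31 7])]; [:: (6, [:: N 0 0 9; N 1 3 17; P 2 4 17]);
(10, [:: N 1 8 17]); (14, [:: N 1 12 17])]; [:: (16, [:: N 1 12 20;
N 3 14 24])]; [:: (6, [:: P 5 2 0]); (10, [:: N 4 7 0]); (27, [:: P 5 24 0])];
[:: (2, [:: P 0 0 7]); (11, [:: P 0 10 7; N 4 7 1]); (15, [:: P 0 14 7]); (20,
[:: P 0 18 7])]; [:: (4, [:: N 0 0 8]); (16, [:: P 6 13 12]); (22,
[:: P 6 17 12])]; [:: (5, [:: N 0 0 9; P 2 4 17]); (23, [:: P 2 22 17;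
P 6 17 13]); (26, [:: P 2 25 17]); (30, [:: P 2 29 17])]; [:: (1,
[:: P 3 0 24]); (19, [:: P 3 18 24]); (28, [:: P 3 27 24; N 5 24 2]); (32,
[:: P 3 31 24])]; [:: (21, [:: P 7 17 29]); (33, [:: P 2 29 22; P 7 30 29])]];
    [:: [:: (6, [:: P 1 2 7]); (27, [:: P 1 24 7])]; [:: (21, [:: N 3 17 17]);
(33, [:: P 2 29 13; N 3 30 17])]; [:: (16, [:: P 3 13 17; N 5 12 30])];
[:: (6, [:: N 0 0 2; P 4 1 24]); (10, [:: P 4 7 24])]; [:: (1, [:: P 0 0 0]);
(19, [:: P 6 17 0]); (28, [:: P 0 27 0; P 1 24 10]); (32, [:: P 0 31 0])];
[:: (11, [:: P 0 10 0; P 4 7 27]); (15, [:: P 0 14 0; N 6 13 0]); (20,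
[:: P 0 18 0; N 6 17 0])]; [:: (5, [:: N 1 2 8; P 2 4 12]); (9,
[:: P 7 7 12]); (23, [:: P 2 22 12]); (26, [:: N 1 24 8; P 2 25 12]); (30,
[:: P 2 29 12])]; [:: (5, [:: P 8 2 29]); (9, [:: N 4 7 25; P 5 8 29]); (13,
[:: P 5 12 29]); (23, [:: P 3 17 22; P 5 21 29]); (26, [:: P 8 24 29])]];
    [:: [:: (6, [:: P 0 3 0; N 1 4 0; P 3 0 14; N 4 1 18]); (14,
[:: P 0 12 0])]; [:: (11, [:: N 0 8 1; P 2 9 7; P 4 7 19]); (15,
[:: P 2 13 7]); (20, [:: P 2 17 7])]; [:: (16, [:: N 0 12 3; P 2 13 8;
N 3 14 12])]; [:: (5, [:: N 5 2 17]); (9, [:: N 4 7 17]); (23, [:: N 2 17 9;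
P 3 18 13; N 4 19 17; P 6 17 26]); (26, [:: N 5 24 17])]; [:: (19,
[:: N 6 17 24]); (28, [:: P 1 25 2; P 5 24 20; N 6 26 24]); (32, [:: P 1 29 2;
N 6 30 24])]; [:: (3, [:: N 7 0 29]); (33, [:: P 1 29 4; N 6 30 25;
N 7 31 29])]; [:: (5, [:: P 0 3 0; P 3 0 14; N 4 1 18]); (9, [:: P 0 8 0;
N 4 7 18]); (13, [:: P 0 12 0]); (23, [:: P 1 22 0]); (26, [:: P 1 25 0]);
(30, [:: P 1 29 0])]; [:: (1, [:: P 3 0 12]); (19, [:: N 2 17 8; P 3 18 12]);
(28, [:: P 3 27 12]); (32, [:: P 3 31 12])]; [:: (11, [:: P 7 10 29]); (15,
[:: P 0 12 4; P 7 14 29]); (20, [:: P 6 17 25; P 7 18 29])]];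
    [:: [:: (3, [:: P 1 0 18]); (21, [:: P 3 17 0]); (33, [:: P 0 29 10;
P 1 31 18; P 3 30 0])]; [:: (16, [:: P 2 12 27; N 3 13 0])]; [:: (5,
[:: P 0 4 7]); (23, [:: P 0 22 7]); (26, [:: P 0 25 7]); (30, [:: P 0 29 7])];
[:: (6, [:: P 0 4 8; N 4 1 12]); (10, [:: N 4 7 12])]; [:: (1, [:: P 1 0 17]);
(28, [:: P 1 27 17; N 5 24 30]); (32, [:: P 1 31 17])]; [:: (11,
[:: N 1 10 17; P 4 7 13]); (15, [:: N 1 14 17]); (20, [:: N 1 18 17])];
[:: (5, [:: P 1 0 20; P 2 3 24]); (9, [:: P 2 8 24]); (13, [:: P 2 12 24]);
(23, [:: P 2 21 24; P 3 17 2])]; [:: (6, [:: N 1 0 22; N 2 3 25; P 5 2 29]);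
(27, [:: P 5 24 29])]];
    [:: [:: (16, [:: N 2 12 7])]; [:: (6, [:: N 4 0 17])]; [:: (33,
[:: P 5 29 24])]; [:: (5, [:: P 0 1 0]); (9, [:: P 0 7 0]); (23, [:: P 0 19 0;
N 3 17 14]); (26, [:: N 1 24 0])]; [:: (19, [:: P 3 17 12]); (28,
[:: P 1 24 3; P 3 26 12]); (32, [:: P 3 30 12])]; [:: (11, [:: P 0 7 4;
P 6 9 29]); (15, [:: P 6 13 29]); (20, [:: P 6 17 29])]];
    [:: [:: (28, [:: N 0 27 0; N 3 26 18; N 4 24 27; P 5 25 31]); (32,
[:: N 0 31 0; N 3 30 18; P 5 29 31])]; [:: (2, [:: N 0 0 0]); (11,
[:: N 0 10 0; P 1 7 10; P 2 8 14; N 3 9 18]); (15, [:: N 0 14 0; P 2 12 14;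
N 3 13 18]); (20, [:: N 0 18 0; N 3 17 18])]; [:: (3, [:: P 1 1 7]); (8,
[:: P 1 7 7]); (21, [:: P 1 19 7]); (33, [:: N 0 31 1; P 1 32 7; N 3 30 19;
P 5 29 32])]; [:: (5, [:: P 1 1 8; P 2 3 12]); (9, [:: P 1 7 8; P 2 8 12]);
(13, [:: P 2 12 12]); (23, [:: P 1 19 8; P 2 21 12])]; [:: (6, [:: N 0 0 5;
P 1 1 9; P 2 3 13; N 3 5 17; N 4 2 26; P 5 4 30]); (10, [:: P 1 7 9; P 2 8 13;
N 3 9 17]); (14, [:: P 2 12 13; N 3 13 17]); (18, [:: N 3 17 17]); (27,
[:: N 3 26 17; N 4 24 26; P 5 25 30]); (31, [:: N 3 30 17; P 5 29 30])];
[:: (4, [:: P 0 0 2; P 4 2 24]); (16, [:: P 0 14 2; N 2 12 15; P 3 13 20;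
P 4 15 24]); (22, [:: P 0 18 2; P 3 17 20; P 4 20 24]); (25, [:: P 4 24 24])];
[:: (5, [:: N 0 0 4; N 4 2 25; P 5 4 29]); (23, [:: N 0 18 4; N 3 17 22;
N 4 20 25; P 5 22 29]); (26, [:: N 4 24 25; P 5 25 29]); (30,
[:: P 5 29 29])]];
    [:: [:: (6, [:: N 0 0 0])]; [:: (28, [:: P 1 24 7])]; [:: (33,
[:: P 2 29 12])]; [:: (23, [:: N 3 17 17])]; [:: (11, [:: N 4 7 24])];
[:: (16, [:: P 5 12 29])]]]%N.

(* The a-th entry is an x (x) y in Q_0 for which b |-> xby detects the coordinate
   a of b: it lies in the socle exactly if b = a. *)
Definition dual_data : seq (nat * nat * nat) :=
[:: (0, 0, 6); (4, 7, 27); (1, 24, 10); (5, 12, 31); (2, 29, 14); (3, 17, 18);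
(0, 0, 0); (4, 7, 28); (5, 12, 32); (3, 17, 19); (0, 0, 1); (1, 24, 7);
(5, 12, 33); (3, 17, 21); (0, 0, 3); (1, 24, 8); (2, 29, 12); (3, 17, 23);
(0, 0, 5); (4, 7, 26); (1, 24, 9); (5, 12, 30); (2, 29, 13); (3, 17, 17);
(1, 24, 11); (2, 29, 15); (3, 17, 20); (0, 0, 2); (4, 7, 24); (2, 29, 16);
(3, 17, 22); (0, 0, 4); (4, 7, 25); (5, 12, 29)]%N.

Definition per (k : nat) := (k %% 22)%N.
Definition summands k := nth [::] summands_data (per k).
(** The default 34 is the zero of R, so a summand number beyond the list carries no basis element.
    Checks can therefore run over s < 9 for every k, nine being the largest number of summands. *)
Definition lidem k s := (nth (34, 34) (summands k) s).1%N.
Definition ridem k s := (nth (34, 34) (summands k) s).2%N.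
Definition diff_terms k s := nth [::] (nth [::] diff_data (per k)) s.
Definition htpy_terms k s x : seq term :=
  let l := nth [::] (nth [::] htpy_data (per k)) s in
  (nth (34%N, [::]) l (find (fun q => q.1 == x) l)).2.

Lemma per_small k : (per k < 22)%N. Proof. by rewrite ltn_mod. Qed.
Lemma per_id k : per (per k) = per k. Proof. exact: modn_mod. Qed.
Lemma perS k : per (per k).+1 = per k.+1.
Proof. by rewrite /per -addn1 modnDml addn1. Qed.

(** * Associativity and the identities of the resolution *)

Lemma bm_check :
  all (fun r => (size r == 34%N) && all (geq 34) r) bmul_table &&
  all (fun i => all (fun j => all (fun l => bm (bm i j) l == bm i (bm j l))
    (iota 0 34)) (iota 0 34)) (iota 0 34).
Proof. by vm_compute. Qed.

Lemma bm_outl x y : (34 <= x)%N -> bm x y = 34%N.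
Proof. by move=> x34; rewrite /bm (nth_default [::]) // nth_nil. Qed.

Lemma bm_outr x y : (34 <= y)%N -> bm x y = 34%N.
Proof.
move=> y34; have [x34|x34] := leqP 34 x; first exact: bm_outl.
rewrite /bm nth_default //; have /andP[/allP h _] := bm_check.
by have /andP[/eqP-> _] := h _ (mem_nth [::] (x34 : x < size bmul_table)%N).
Qed.

Lemma bm_le x y : (bm x y <= 34)%N.
Proof.
have [x34|x34] := leqP 34 x; first by rewrite bm_outl.
have [y34|y34] := leqP 34 y; first by rewrite bm_outr.
have /andP[/allP h _] := bm_check.
have /andP[/eqP s /allP r] := h _ (mem_nth [::] (x34 : x < size bmul_table)%N).
by apply: r; rewrite /bm mem_nth // s.
Qed.

Lemma bmA x y z : bm (bm x y) z = bm x (bm y z).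
Proof.
have [x34|x34] := leqP 34 x; first by rewrite !(bm_outl _ x34) bm_outl.
have [y34|y34] := leqP 34 y.
  by rewrite (bm_outr _ y34) (bm_outl _ y34) bm_outl // bm_outr.
have [z34|z34] := leqP 34 z; first by rewrite !(bm_outr _ z34) bm_outr.
have /andP[_ /allP/(_ x)] := bm_check; rewrite mem_iota x34 => /(_ isT)/allP/(_ y).
by rewrite mem_iota y34 => /(_ isT)/allP/(_ z); rewrite mem_iota z34 => /(_ isT)/eqP.
Qed.

(** The triple (s, x, y) is a basis element x (x) y of the summand e_i R (x) R e_j number s of
    Q_k. *)
Definition good k (w : nat * nat * nat) :=
  let: (s, x, y) := w in
  [&& (s < 9)%N, (x < 34)%N, (y < 34)%N, bm (lidem k s) x == x
    & bm y (ridem k s) == y].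

(* The formulas for the values of a function on Q_k also hold if x or y is 0. *)
Definition weak k (w : nat * nat * nat) :=
  good k w || (w.1.2 == 34%N) || (w.2 == 34%N).

Lemma weak_mulr k s x y a : weak k (s, x, y) -> weak k (s, bm x a, y).
Proof.
rewrite /weak /=; case/orP=> [/orP[/and5P[s9 x34 y34 /eqP xi yj]|/eqP->]|->].
- have := bm_le x a; rewrite leq_eqVlt => /orP[->|xa]; first by rewrite orbT.
  by rewrite s9 xa y34 -bmA xi eqxx yj.
- by rewrite bm_outl // eqxx orbT.
- by rewrite orbT.
Qed.

Lemma weak_mull k s x y a : weak k (s, x, y) -> weak k (s, x, bm a y).
Proof.
rewrite /weak /=; case/orP=> [/orP[/and5P[s9 x34 y34 xi /eqP yj]|->]|/eqP->].
- have := bm_le a y; rewrite leq_eqVlt => /orP[->|xa]; first by rewrite !orbT.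
  by rewrite s9 xa x34 bmA yj eqxx xi.
- by rewrite orbT.
- by rewrite bm_outr // eqxx !orbT.
Qed.

Definition valid k (p : term) :=
  let: (_, (s, u, v)) := p in
  [&& (s < 9)%N, bm (lidem k s) u == u & bm v (ridem k s) == v].

Lemma valid_weak k c s u v x y :
  valid k (c, (s, u, v)) -> weak k (s, bm u x, bm y v).
Proof.
move=> /and3P[s9 /eqP ui /eqP vj]; rewrite /weak /= s9 -bmA ui bmA vj !eqxx.
have := bm_le u x; rewrite leq_eqVlt => /orP[->|->]; first by rewrite orbT.
by have := bm_le y v; rewrite leq_eqVlt => /orP[->|->]; rewrite ?orbT.
Qed.

Lemma valid_weak1 k c s x v y :
  valid k (c, (s, x, v)) -> (x < 34)%N -> weak k (s, x, bm y v).
Proof.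
move=> /and3P[s9 /eqP ui /eqP vj] x34; rewrite /weak /= s9 x34 ui bmA vj !eqxx.
by have := bm_le y v; rewrite leq_eqVlt => /orP[->|->]; rewrite ?orbT.
Qed.

Definition alive (p : term) := (p.2.1.2 < 34)%N && (p.2.2 < 34)%N.

(** Decides whether a formal signed sum is zero by removing each term together with an opposite one.
    The number n is fuel, since [rem] does not give a structural subterm. *)
Fixpoint cancels (n : nat) (l : seq term) : bool :=
  match n, l with
  | _, [::] => true
  | n.+1, (b, w) :: l => ((~~ b, w) \in l) && cancels n (rem (~~ b, w) l)
  | 0, _ => false
  end.

Definition vanishes (l : seq term) :=
  let l := filter alive l in cancels (size l) l.

Lemma vanishes_sum (K : fieldType) (F : nat * nat * nat -> K) l :
  (forall s x y, ~~ ((x < 34) && (y < 34))%N -> F (s, x, y) = 0) ->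
  vanishes l -> \sum_(p <- l) (-1) ^+ p.1 * F p.2 = 0.
Proof.
move=> F0 lv; rewrite (bigID alive) /= [X in _ + X]big1 ?addr0; last first.
  by move=> [b [[s x] y]] /F0 -> /=; rewrite mulr0.
rewrite -big_filter; move: lv; rewrite /vanishes /=.
move: (filter alive l) => {}l; move: (size l) => n.
elim: n l => [|n IH] [|[b w] l] //=; rewrite ?big_nil //.
move=> /andP[bl lc]; rewrite big_cons (perm_big _ (perm_to_rem bl)) big_cons /=.
by rewrite IH // addr0 -mulrDl signrN subrr mul0r.
Qed.

(** The composite Q_(k+1) -> Q_k -> Q_(k+1) on x (x) y. In this and the next two lists the third
    component is the factor by which y is multiplied on the right, so y itself stays generic. *)
Definition diff_htpy k s x : seq term :=
  flatten [seq let: (c, (s1, u, v)) := p in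
     [seq let: (c2, (s2, x2, v2)) := q in (c (+) c2, (s2, x2, bm v v2))
     | q <- htpy_terms k s1 (bm u x)] | p <- diff_terms k s].

Definition htpy_diff k s x : seq term :=
  flatten [seq let: (c, (s1, x1, v)) := p in
     [seq let: (c2, (s2, u2, v2)) := q in (c (+) c2, (s2, bm u2 x1, bm v v2))
     | q <- diff_terms k s1] | p <- htpy_terms k s x].

Definition diff_diff k s : seq term :=
  flatten [seq let: (c, (s1, u, v)) := p in
     [seq let: (c2, (s2, u2, v2)) := q in (c (+) c2, (s2, bm u2 u, bm v v2))
     | q <- diff_terms k s1] | p <- diff_terms k.+1 s].

(** The identity hd + dh = 1 on Q_(k+1). As right factors are multipliers of y, the identity map is
    the term with multiplier e_j. *)
Definition htpy_check k s x :=
  vanishes ((true, (s, x, ridem k.+1 s)) :: diff_htpy k s x ++ htpy_diff k.+1 s x).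

Definition lidem_check k s :=
  (lidem k s == 34%N) || (lidem k s < 34)%N && (bm (lidem k s) (lidem k s) == lidem k s).

(* u lies in e_i' A e_i and v in e_j A e_j' *)
Definition diff_valid k s (p : term) :=
  [&& valid k p, bm p.2.1.2 (lidem k.+1 s) == p.2.1.2
    & bm (ridem k.+1 s) p.2.2 == p.2.2].

Definition htpy_valid k (p : term) := valid k.+1 p && (p.2.1.2 < 34)%N.

Definition summand_check k s :=
  [&& lidem_check k s, all (diff_valid k s) (diff_terms k s),
      vanishes (diff_diff k s), htpy_terms k s 34 == [::]
    & all (fun x => all (htpy_valid k) (htpy_terms k s x)) (iota 0 34) &&
      all (fun x => (bm (lidem k.+1 s) x == x) ==> htpy_check k s x) (iota 0 34)].

Lemma summand_check_all :
  all (fun k => all (summand_check k) (iota 0 9)) (iota 0 22).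
Proof. by vm_compute. Qed.

(** All tables read k through [per], so the 22 computed cases give every k. *)
Lemma summand_checkP k s : (s < 9)%N -> summand_check k s.
Proof.
move=> s9; have /allP/(_ (per k)) := summand_check_all.
rewrite mem_iota per_small => /(_ isT)/allP/(_ s); rewrite mem_iota s9 => /(_ isT).
have lE s' : lidem (per k) s' = lidem k s' by rewrite /lidem /summands per_id.
have lSE s' : lidem (per k).+1 s' = lidem k.+1 s' by rewrite /lidem /summands perS.
have rE s' : ridem (per k) s' = ridem k s' by rewrite /ridem /summands per_id.
have rSE s' : ridem (per k).+1 s' = ridem k.+1 s' by rewrite /ridem /summands perS.
have dE s' : diff_terms (per k) s' = diff_terms k s'.
  by rewrite /diff_terms per_id.
have dSE s' : diff_terms (per k).+1 s' = diff_terms k.+1 s'.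
  by rewrite /diff_terms perS.
have hE s' x : htpy_terms (per k) s' x = htpy_terms k s' x.
  by rewrite /htpy_terms per_id.
have hSE s' x : htpy_terms (per k).+1 s' x = htpy_terms k.+1 s' x.
  by rewrite /htpy_terms perS.
have vE : valid (per k) =1 valid k by move=> [c [[s' u] v]] /=; rewrite lE rE.
have vSE : valid (per k).+1 =1 valid k.+1.
  by move=> [c [[s' u] v]] /=; rewrite lSE rSE.
move=> /and5P[h1 h2 h3 h4 /andP[h5 h6]].
apply/and5P; split; last apply/andP; last split.
- by move: h1; rewrite /lidem_check lE.
- by move: h2; rewrite dE (eq_all (a2 := diff_valid k s)) // => p;
     rewrite /diff_valid vE lSE rSE.
- move: h3; congr (vanishes _); rewrite /diff_diff dSE; congr flatten.
  by apply: eq_map => -[c [[s1 u] v]]; rewrite dE.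
- by move: h4; rewrite hE.
- apply: sub_all h5 => x; rewrite hE (eq_all (a2 := htpy_valid k)) // => p.
  by rewrite /htpy_valid vSE.
- apply: sub_all h6 => x; rewrite lSE; congr (_ ==> vanishes _).
  rewrite rSE /diff_htpy /htpy_diff dE hSE; congr (_ :: flatten _ ++ flatten _).
    by apply: eq_map => -[c [[s1 u] v]]; rewrite hE.
  by apply: eq_map => -[c [[s1 u] v]]; rewrite dSE.
Qed.

Lemma bmul_tableP : mkseq (fun i => mkseq (bmul_spec i) 34) 34 == bmul_table.
Proof. by vm_compute. Qed.

Lemma bm_spec i j : (i < 34)%N -> (j < 34)%N -> bm i j = bmul_spec i j.
Proof.
by move=> i34 j34; rewrite /bm -(eqP bmul_tableP) !nth_mkseq.
Qed.

Lemma mulR_coef (K : fieldType) (i j l : 'I_dR) : mulR K i j 0 l = (bm i j == l)%:R.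
Proof.
have l34 : (l < 34)%N := ltn_ord l.
have l34F : (34 == l)%N = false by apply/eqP => h; rewrite -h in l34.
rewrite bm_spec ?ltn_ord // /bmul_spec /mulR.
case: ifP => _; last by rewrite l34F mxE.
case: normalize => [q|]; last by rewrite l34F mxE.
case: ifP => [qR|_]; last by rewrite l34F mxE.
rewrite mxE /= eq_sym -val_eqE /= inordK //.
by move: qR; rewrite -index_mem.
Qed.

(** A product index x = 34 stands for 0 and does not occur in the sum over k < 34; the condition on
    F 34 makes both sides agree there. *)
Lemma sum_bm (K : fieldType) (F : nat -> K) x : (x <= 34)%N -> F 34%N = 0 ->
  \sum_(k < dR) (x == k)%:R * F k = F x.
Proof.
rewrite leq_eqVlt => /orP[/eqP->|x34] F0.
  by rewrite F0 big1 // => k _; case: eqP => [h|]; rewrite ?mul0r // -h F0 mulr0.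
rewrite (bigD1 (Ordinal (x34 : x < dR)%N)) //= eqxx mul1r big1 ?addr0 // => k.
by rewrite -val_eqE eq_sym /= => /negbTE->; rewrite mul0r.
Qed.

Lemma mulR_A (K : fieldType) (a b c l : 'I_dR) :
  \sum_k mulR K a b 0 k * mulR K k c 0 l = \sum_k mulR K b c 0 k * mulR K a k 0 l.
Proof.
have l34 : (34 == l)%N = false.
  by apply/eqP => h; have := ltn_ord l; rewrite -h.
under eq_bigr => k _ do rewrite !mulR_coef.
under [RHS]eq_bigr => k _ do rewrite !mulR_coef.
rewrite (sum_bm (F := fun k => (bm k c == l)%:R) (bm_le _ _)); last first.
  by rewrite bm_outl // l34.
rewrite (sum_bm (F := fun k => (bm a k == l)%:R) (bm_le _ _)) ?bmA //.
by rewrite bm_outr // l34.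
Qed.

(** * The coresolution of R *)

(** The six basis paths of length 4, one starting at each vertex. The sum of the coordinates at them
    is a Frobenius form on R, whose Nakayama permutation exchanges the vertices 1 and 5 and the
    vertices 2 and 6. *)
Definition socle : seq nat := [:: 6; 11; 16; 23; 28; 33]%N.

Lemma socle_lt z : z \in socle -> (z < 34)%N.
Proof. by move=> zs; apply: (allP (isT : all (ltn^~ 34) socle)). Qed.

(** The augmentation from Q_0 to the dual of R is x (x) y |-> (a |-> frob(xay)). The three parts: it
    kills the image of Q_1 (the range 35 includes the zero element); the section given by
    [dual_data] and the homotopy contract this end of the complex; [dual_data] is dual to the basis
    of R. *)
Lemma frob_emb_check :
  [&& all (fun s => all (fun b =>
        count (fun p => ~~ p.1 && (bm (bm p.2.1.2 b) p.2.2 \in socle)) (diff_terms 0 s) ==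
        count (fun p => p.1 && (bm (bm p.2.1.2 b) p.2.2 \in socle)) (diff_terms 0 s))
        (iota 0 35)) (iota 0 9),
      all (fun s => all (fun x => all (fun y => good 0 (s, x, y) ==>
        vanishes ((true, (s, x, y)) ::
          [seq (false, nth (9, 34, 34)%N dual_data a)
            | a <- [seq a <- iota 0 34 | bm (bm x a) y \in socle]] ++
          [seq (p.1, (p.2.1, bm y p.2.2)) | p <- htpy_diff 0 s x]))
        (iota 0 34)) (iota 0 34)) (iota 0 9)
    & all (fun a => let w := nth (9, 34, 34)%N dual_data a in good 0 w &&
        all (fun b => (bm (bm w.1.2 b) w.2 \in socle) == (b == a)) (iota 0 34))
        (iota 0 34)].
Proof. by vm_compute. Qed.

Section Modules.
Variable K : fieldType.
Local Notation mul := (@mulR K).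
Local Notation mulA := (@mulR_A K).

(** * The duals of the bimodules Q_k *)

Definition cells k : seq (nat * nat * nat) :=
  [seq w <- [seq (sx, y) | sx <- [seq (s, x) | s <- iota 0 9, x <- iota 0 34],
                           y <- iota 0 34] | good k w].

Lemma mem_cells k w : (w \in cells k) = good k w.
Proof.
rewrite mem_filter andb_idr //; case: w => [[s x] y] /and5P[s9 x34 y34 _ _].
apply/allpairsP; exists ((s, x), y); split; rewrite ?mem_iota //.
by apply/allpairsP; exists (s, x); rewrite !mem_iota.
Qed.

(* The dual of Q_k, with (a f)(x (x) y) = f (xa (x) y) and
   (f a)(x (x) y) = f (x (x) ay). *)
Definition space k : vectType K := {ffun seq_sub (cells k) -> K^o}.

(** Extended by 0 outside the basis, so that formulas stay meaningful when a product vanishes. *)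
Definition ev k (f : space k) (w : nat * nat * nat) : K :=
  if insub w is Some u then (f : {ffun _ -> _}) (u : seq_sub (cells k)) else 0.

Lemma ev_bad k (f : space k) w : ~~ good k w -> ev f w = 0.
Proof. by rewrite -mem_cells => wk; rewrite /ev insubN. Qed.

Lemma ev_outl k (f : space k) s x y : (34 <= x)%N -> ev f (s, x, y) = 0.
Proof.
by move=> x34; apply/ev_bad/negP => /and5P[_ h _ _ _]; rewrite leqNgt h in x34.
Qed.

Lemma ev_outr k (f : space k) s x y : (34 <= y)%N -> ev f (s, x, y) = 0.
Proof.
by move=> y34; apply/ev_bad/negP => /and5P[_ _ h _ _]; rewrite leqNgt h in y34.
Qed.

Lemma ev_ext k (f g : space k) :
  (forall w, good k w -> ev f w = ev g w) -> f = g.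
Proof.
move=> fg; apply/ffunP => u; have := fg (val u).
by rewrite /ev valK; apply; rewrite -mem_cells (valP u).
Qed.

Lemma evP k c (f g : space k) w : ev (c *: f + g) w = c * ev f w + ev g w.
Proof. by rewrite /ev; case: insub => [u|]; rewrite ?ffunE ?mulr0 ?addr0. Qed.

Lemma ev0 k w : ev (0 : space k) w = 0.
Proof. by rewrite /ev; case: insub => [u|] //; rewrite ffunE. Qed.

Lemma ev_sum k n (c : 'I_n -> K) (f : 'I_n -> space k) w :
  ev (\sum_i c i *: f i) w = \sum_i c i * ev (f i) w.
Proof.
elim/big_rec2: _ => [|i a b _ <-]; first exact: ev0.
exact: evP.
Qed.

Definition mk k (F : nat * nat * nat -> K) : space k := [ffun u => F (val u)].

Lemma ev_mk k F w : good k w -> ev (mk k F) w = F w.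
Proof.
by rewrite -mem_cells => wk; rewrite /ev insubT ffunE.
Qed.

Definition evs k (f : space k) (l : seq term) : K :=
  \sum_(p <- l) (-1) ^+ p.1 * ev f p.2.

Definition op k k' (G : nat * nat * nat -> seq term) : 'Hom(space k, space k') :=
  linfun (fun f => mk k' (fun w => evs f (G w))).

Lemma opE k k' G f w : good k' w -> ev (@op k k' G f) w = evs f (G w).
Proof.
move=> wk; rewrite linfunE ?ev_mk // => c g h; apply/ffunP => u.
rewrite !ffunE /evs /= scaler_sumr -big_split /=; apply: eq_bigr => p _.
by rewrite evP mulrDr mulrCA.
Qed.

Lemma evs1 k (f : space k) w : evs f [:: (false, w)] = ev f w.
Proof. by rewrite /evs big_seq1 mul1r. Qed.

Definition coind_lact k (a : 'I_dR) : 'End(space k) :=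
  op k k (fun w => [:: (false, (w.1.1, bm w.1.2 a, w.2))]).
Definition coind_ract k (a : 'I_dR) : 'End(space k) :=
  op k k (fun w => [:: (false, (w.1.1, w.1.2, bm a w.2))]).

Lemma weakP k s x y : weak k (s, x, y) ->
  good k (s, x, y) \/ (34 <= x)%N \/ (34 <= y)%N.
Proof. by rewrite /weak /= => /orP[/orP[->|/eqP->]|/eqP->]; auto. Qed.

Lemma good_weak k w : good k w -> weak k w.
Proof. by rewrite /weak => ->. Qed.

Lemma ev_lact k a f s x y : weak k (s, x, y) ->
  ev (coind_lact k a f) (s, x, y) = ev f (s, bm x a, y).
Proof.
move=> /weakP[w|[w|w]]; first by rewrite opE // evs1.
  by rewrite !ev_outl // bm_outl.
by rewrite !ev_outr.
Qed.

Lemma ev_ract k a f s x y : weak k (s, x, y) ->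
  ev (coind_ract k a f) (s, x, y) = ev f (s, x, bm a y).
Proof.
move=> /weakP[w|[w|w]]; first by rewrite opE // evs1.
  by rewrite !ev_outl.
by rewrite !ev_outr // bm_outr.
Qed.

Lemma coind_lactA k a b f : coind_lact k a (coind_lact k b f) =
  \sum_c mul a b 0 c *: coind_lact k c f.
Proof.
apply: ev_ext => -[[s x] y] /good_weak w; rewrite ev_sum ev_lact // ev_lact ?weak_mulr //.
under eq_bigr => c _ do rewrite mulR_coef ev_lact //.
rewrite (sum_bm (F := fun c => ev f (s, bm x c, y)) (bm_le _ _)) ?bmA //.
by rewrite bm_outr // ev_outl.
Qed.

Lemma coind_ractA k a b f : coind_ract k b (coind_ract k a f) =
  \sum_c mul a b 0 c *: coind_ract k c f.
Proof.
apply: ev_ext => -[[s x] y] /good_weak w; rewrite ev_sum ev_ract // ev_ract ?weak_mull //.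
under eq_bigr => c _ do rewrite mulR_coef ev_ract //.
rewrite (sum_bm (F := fun c => ev f (s, x, bm c y)) (bm_le _ _)) ?bmA //.
by rewrite bm_outl // ev_outr.
Qed.

Lemma coind_lractC k a b f :
  coind_lact k a (coind_ract k b f) = coind_ract k b (coind_lact k a f).
Proof.
apply: ev_ext => -[[s x] y] /good_weak w.
rewrite ev_lact // ev_ract ?weak_mulr // ev_ract //.
by rewrite ev_lact ?weak_mull.
Qed.

Definition coind k : bimod mul :=
  Bimod (@coind_lactA k) (@coind_ractA k) (@coind_lractC k).

Lemma good_lidem k s x y : good k (s, x, y) -> good k (s, lidem k s, y).
Proof.
move=> /and5P[s9 x34 y34 /eqP xi yj]; rewrite /= s9 y34 yj.
have /and5P[+ _ _ _ _] := summand_checkP k s9.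
move=> /orP[/eqP l34|/andP[-> ->]] //.
by rewrite l34 bm_outl // in xi; rewrite -xi in x34.
Qed.

(** The dual of e_i R (x) R e_j is coinduced in the left factor: T_l f takes x (x) y to f(e_i (x) y)
    if x = b_l and to 0 otherwise. Every f is recovered because (b_l f)(e_i (x) y) = f(b_l (x)
    y). *)
Lemma relinj_coind k : relinj (coind k).
Proof.
pose T (l : 'I_dR) := op k k (fun w =>
  if w.1.2 == l then [:: (false, (w.1.1, lidem k w.1.1, w.2))] else [::]).
have evT (l : 'I_dR) f s x y : weak k (s, x, y) ->
    ev (T l f) (s, x, y) = if x == l then ev f (s, lidem k s, y) else 0.
  move=> /weakP[w|[w|w]].
  - by rewrite opE //=; case: eqP => _; rewrite ?evs1 // /evs big_nil.
  - rewrite ev_outl //; case: eqP => // xl.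
    by have := ltn_ord l; rewrite -xl ltnNge w.
  - by rewrite !ev_outr // if_same.
exists T; split=> [f|l a f|l a f]; apply: ev_ext => -[[s x] y] wg;
  have w := good_weak wg; have wl := good_weak (good_lidem wg).
- have /and5P[_ x34 _ /eqP xi _] := wg.
  have -> : \sum_i T i (lact (coind k) i f) = \sum_i 1 *: T i (coind_lact k i f).
    by apply: eq_bigr => i _; rewrite scale1r.
  rewrite ev_sum (bigD1 (Ordinal (x34 : x < dR)%N)) //= evT //= eqxx ev_lact //.
  rewrite /= xi mul1r big1 ?addr0 // => j; rewrite -val_eqE /= eq_sym evT //.
  by move=> /negbTE->; rewrite mulr0.
- have /and5P[_ x34 _ _ _] := wg.
  rewrite ev_sum [LHS]ev_lact // evT ?weak_mulr //.
  rewrite (bigD1 (Ordinal (x34 : x < dR)%N)) //= evT //= eqxx mulR_coef /=.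
  rewrite big1 ?addr0; last first.
    by move=> j; rewrite -val_eqE /= eq_sym evT // => /negbTE->; rewrite mulr0.
  by case: eqP => _; rewrite ?mul1r ?mul0r.
- rewrite [LHS]ev_ract // !evT ?weak_mull //; case: eqP => // _.
  by rewrite [RHS]ev_ract.
Qed.

(** * Differential and contracting homotopy on the duals *)

Definition diff k : 'Hom(coind k, coind k.+1) :=
  op k k.+1 (fun w => [seq let: (c, (s, u, v)) := p in
    (c, (s, bm u w.1.2, bm w.2 v)) | p <- diff_terms k w.1.1]).

Lemma ev_diff k (f : coind k) s x y : weak k.+1 (s, x, y) ->
  ev (diff k f) (s, x, y) =
  \sum_(p <- diff_terms k s) (-1) ^+ p.1 * ev f (p.2.1.1, bm p.2.1.2 x, bm y p.2.2).
Proof.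
have z : (forall p : term, ev f (p.2.1.1, bm p.2.1.2 x, bm y p.2.2) = 0) ->
    0 = \sum_(p <- diff_terms k s)
      (-1) ^+ p.1 * ev f (p.2.1.1, bm p.2.1.2 x, bm y p.2.2).
  by move=> h; rewrite big1 // => p _; rewrite h mulr0.
move=> /weakP[w|[w|w]].
- by rewrite opE // /evs big_map; apply: eq_bigr => -[c [[s1 u] v]].
- by rewrite ev_outl //; apply: z => p; rewrite ev_outl // bm_outr.
- by rewrite ev_outr //; apply: z => p; rewrite ev_outr // bm_outl.
Qed.

Lemma diff_validP k s p : (s < 9)%N -> p \in diff_terms k s -> diff_valid k s p.
Proof. by move=> s9; have /and5P[_ /allP + _ _ _] := summand_checkP k s9; apply. Qed.

Lemma diff_term_weak k s x y p : (s < 9)%N -> p \in diff_terms k s ->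
  weak k (p.2.1.1, bm p.2.1.2 x, bm y p.2.2).
Proof.
case: p => [c [[s1 u] v]] s9 /(diff_validP s9)/and3P[h _ _].
exact: valid_weak h.
Qed.

Lemma bmor_diff k : bmor (diff k).
Proof.
split=> a f; apply: ev_ext => -[[s x] y] wg; have w := good_weak wg;
  have /and5P[s9 _ _ _ _] := wg; rewrite [LHS]ev_diff //.
- rewrite [RHS]ev_lact // ev_diff ?weak_mulr //; apply: eq_big_seq => p ps.
  by rewrite [ev _ _]ev_lact ?bmA //; apply: diff_term_weak ps.
- rewrite [RHS]ev_ract // ev_diff ?weak_mull //; apply: eq_big_seq => p ps.
  by rewrite [ev _ _]ev_ract ?bmA //; apply: diff_term_weak ps.
Qed.

Definition htpy k : 'Hom(coind k.+1, coind k) :=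
  op k.+1 k (fun w => [seq let: (c, (s, x, v)) := p in
    (c, (s, x, bm w.2 v)) | p <- htpy_terms k w.1.1 w.1.2]).

Lemma ev_htpy k (f : coind k.+1) s x y : (s < 9)%N -> (x <= 34)%N -> weak k (s, x, y) ->
  ev (htpy k f) (s, x, y) =
  \sum_(p <- htpy_terms k s x) (-1) ^+ p.1 * ev f (p.2.1.1, p.2.1.2, bm y p.2.2).
Proof.
move=> s9 x34 /weakP[w|[w|w]].
- by rewrite opE // /evs big_map; apply: eq_bigr => -[c [[s1 u] v]].
- have -> : x = 34%N by apply/eqP; rewrite eqn_leq x34 w.
  have /and5P[_ _ _ /eqP-> _] := summand_checkP k s9.
  by rewrite big_nil ev_outl.
- by rewrite ev_outr // big1 // => p _; rewrite ev_outr ?mulr0 // bm_outl.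
Qed.

Lemma diff_diff0 k (f : coind k) : diff k.+1 (diff k f) = 0.
Proof.
apply: ev_ext => -[[s x] y] wg; have w := good_weak wg.
have /and5P[s9 _ _ _ _] := wg; rewrite ev0 ev_diff //.
have /and5P[_ _ + _ _] := summand_checkP k s9.
pose F (z : nat * nat * nat) := ev f (z.1.1, bm z.1.2 x, bm y z.2).
move=> /(@vanishes_sum _ F) F0; rewrite -[RHS]F0 => [|s1 x1 y1].
  rewrite /diff_diff big_flatten big_map /=; apply: eq_big_seq => -[c [[s1 u] v]] ps /=.
  rewrite big_map ev_diff; last exact: (diff_term_weak _ _ s9 ps).
  rewrite mulr_sumr; apply: eq_bigr => -[c2 [[s2 u2] v2]] _ /=.
  by rewrite /F /= !bmA mulrA signr_addb.
rewrite /F /= negb_and -!leqNgt => /orP[h|h].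
  by rewrite ev_outl // bm_outl.
by rewrite ev_outr // bm_outr.
Qed.

(** For each homotopy term the inner sum over the differential is, up to sign, a value of
    [diff k f]. *)
Lemma htpy_diff_sum k (f : coind k) s x y : diff k f = 0 -> (s < 9)%N -> (x < 34)%N ->
  \sum_(p <- htpy_diff k s x)
    (-1) ^+ p.1 * ev f (p.2.1.1, p.2.1.2, bm y p.2.2) = 0.
Proof.
move=> f0 s9 x34; have /and5P[_ _ _ _ /andP[/allP/(_ x)]] := summand_checkP k s9.
rewrite mem_iota x34 => /(_ isT)/allP hv _.
rewrite /htpy_diff big_flatten big_map /= big_seq big1 // => -[c [[s1 x1] v]] ps /=.
have /andP[pv /= x134] := hv _ ps.
have := ev_diff f (valid_weak1 y pv x134); rewrite f0 ev0 => h.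
rewrite -[RHS](mulr0 ((-1) ^+ c)) [X in _ = _ * X]h big_map mulr_sumr.
apply: eq_bigr => -[c2 [[s2 u2] v2]] _ /=.
by rewrite !bmA mulrA signr_addb.
Qed.

(** The transpose of hd + dh = 1: on a cocycle the summand that applies the next differential to f
    vanishes. *)
Lemma htpyP k (f : coind k.+1) : diff k.+1 f = 0 -> f = diff k (htpy k f).
Proof.
move=> f0; apply: ev_ext => -[[s x] y] wg; have w := good_weak wg.
have /and5P[s9 x34 _ /eqP xi /eqP yj] := wg; rewrite ev_diff //.
have /and5P[_ _ _ _ /andP[_ /allP/(_ x)]] := summand_checkP k s9.
rewrite mem_iota x34 xi eqxx => /(_ isT).
pose F (z : nat * nat * nat) := ev f (z.1.1, z.1.2, bm y z.2).
have Fout s1 x1 y1 : ~~ ((x1 < 34) && (y1 < 34))%N -> F (s1, x1, y1) = 0.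
  rewrite /F /= negb_and -!leqNgt => /orP[h|h]; first by rewrite ev_outl.
  by rewrite ev_outr // bm_outr.
move=> /(vanishes_sum Fout); rewrite big_cons big_cat /= {1}/F /= yj mulN1r.
rewrite (htpy_diff_sum y f0 s9 x34) addr0 => /eqP.
rewrite addrC subr_eq0 => /eqP <-.
rewrite /diff_htpy big_flatten big_map /=; apply: eq_big_seq => -[c [[s1 u] v]] ps /=.
have /and3P[/and3P[s19 _ _] _ _] := diff_validP s9 ps.
rewrite big_map ev_htpy ?bm_le //; last exact: (diff_term_weak _ _ s9 ps).
rewrite mulr_sumr; apply: eq_bigr => -[c2 [[s2 u2] v2]] _ /=.
by rewrite /F /= !bmA mulrA signr_addb.
Qed.

Lemma diff_exact k : limg (diff k) = lker (diff k.+1).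
Proof.
apply/vspaceP => f; rewrite memv_ker; apply/memv_imgP/eqP => [[g _ ->]|f0].
  exact: diff_diff0.
by exists (htpy k f); rewrite ?memvf //; apply: htpyP.
Qed.

(** * The embedding of R given by the Frobenius form *)

Definition frob (z : nat) : K := (z \in socle)%:R.

Lemma frob_out z : (34 <= z)%N -> frob z = 0.
Proof.
rewrite /frob; case: (boolP (z \in socle)) => // /socle_lt.
by rewrite ltnNge => /negbTE->.
Qed.

(** The transpose of the augmentation: v becomes the functional x (x) y |-> frob(xvy). *)
Definition frob_emb_fun (v : 'rV[K]_dR) : coind 0 :=
  mk 0 (fun w => \sum_a v 0 a * frob (bm (bm w.1.2 a) w.2)).

Definition frob_emb : 'Hom(regB mulA, coind 0) := linfun frob_emb_fun.

Lemma ev_frob_emb v s x y : weak 0 (s, x, y) ->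
  ev (frob_emb v) (s, x, y) = \sum_a v 0 a * frob (bm (bm x a) y).
Proof.
rewrite linfunE; last first.
  move=> c u w; apply/ffunP => z; rewrite !ffunE /= scaler_sumr -big_split /=.
  by apply: eq_bigr => a _; rewrite !mxE mulrDl -mulrA.
move=> /weakP[w|[w|w]]; first by rewrite ev_mk.
  by rewrite ev_outl // big1 // => a _; rewrite !bm_outl ?bm_outl // frob_out ?mulr0.
by rewrite ev_outr // big1 // => a _; rewrite bm_outr // frob_out ?mulr0.
Qed.

Lemma bmor_frob_emb : bmor frob_emb.
Proof.
split=> b v; apply: ev_ext => -[[s x] y] /good_weak w; rewrite ev_frob_emb //.
- rewrite [RHS]ev_lact // ev_frob_emb ?weak_mulr //.
  under eq_bigr => l _ do rewrite reg_lact_coef.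
  rewrite (reg_sum v (fun j k => mul b j 0 k) (fun k => frob (bm (bm x k) y))).
  apply: eq_bigr => j _.
  under eq_bigr => l _ do rewrite mulR_coef.
  rewrite (sum_bm (F := fun k => frob (bm (bm x k) y)) (bm_le _ _)) ?bmA //.
  by rewrite (bm_outl _ (leqnn 34)) bm_outr // frob_out.
- rewrite [RHS]ev_ract // ev_frob_emb ?weak_mull //.
  under eq_bigr => l _ do rewrite reg_ract_coef.
  rewrite (reg_sum v (fun j k => mul j b 0 k) (fun k => frob (bm (bm x k) y))).
  apply: eq_bigr => j _.
  under eq_bigr => l _ do rewrite mulR_coef.
  rewrite (sum_bm (F := fun k => frob (bm (bm x k) y)) (bm_le _ _)) ?bmA //.
  by rewrite (bm_outl _ (leqnn 34)) bm_outr // frob_out.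
Qed.

(** Equal numbers of positive and negative terms in the socle can be checked in the naturals, and
    then the sum vanishes in every characteristic. *)
Lemma frob_sum (l : seq term) (g : term -> nat) :
  count (fun p => ~~ p.1 && (g p \in socle)) l =
  count (fun p => p.1 && (g p \in socle)) l ->
  \sum_(p <- l) (-1) ^+ p.1 * frob (g p) = 0.
Proof.
move=> cE; suff -> : \sum_(p <- l) (-1) ^+ p.1 * frob (g p) =
   (count (fun p => ~~ p.1 && (g p \in socle)) l)%:R
   - (count (fun p => p.1 && (g p \in socle)) l)%:R by rewrite cE subrr.
elim: l {cE} => [|[b w] l IH]; first by rewrite big_nil subrr.
rewrite big_cons IH /= /frob; case: b; case: (_ \in _) => /=.
- by rewrite mulr1 add0n natrD opprD addrCA.
- by rewrite mulr0 add0r !add0n.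
- by rewrite mulr1 add0n natrD addrA.
- by rewrite mulr0 add0r !add0n.
Qed.

Lemma diff_frob_emb v : diff 0 (frob_emb v) = 0.
Proof.
apply: ev_ext => -[[s x] y] wg; have w := good_weak wg.
have /and5P[s9 _ _ _ _] := wg; rewrite ev0 ev_diff //.
under eq_big_seq => p ps.
  rewrite ev_frob_emb; last exact: diff_term_weak ps.
  over.
rewrite /=; under eq_bigr => p _ do rewrite mulr_sumr.
rewrite exchange_big /= big1 // => a _.
transitivity (v 0 a * \sum_(p <- diff_terms 0 s) (-1) ^+ p.1 *
    frob (bm (bm p.2.1.2 (bm (bm x a) y)) p.2.2)).
  by rewrite mulr_sumr; apply: eq_bigr => p _; rewrite mulrCA !bmA.
rewrite frob_sum ?mulr0 //.
have /and3P[/allP/(_ s) + _ _] := frob_emb_check; rewrite mem_iota s9 => /(_ isT)/allP.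
move=> /(_ (bm (bm x a) y)); rewrite mem_iota ltnS bm_le => /(_ isT)/eqP.
exact.
Qed.

Lemma frob_emb_inj : lker frob_emb = 0%VS.
Proof.
apply/eqP; rewrite -subv0; apply/subvP => v; rewrite memv_ker memv0 => /eqP v0.
apply/eqP/rowP => a; rewrite mxE.
have /and3P[_ _ /allP/(_ (val a))] := frob_emb_check; rewrite mem_iota ltn_ord => /(_ isT).
case E : (nth _ _ _) => [[s x] y] /andP[wg /allP h].
have := ev_frob_emb v (good_weak wg); rewrite v0 ev0 (bigD1 a) //= big1 ?addr0.
  have := h a; rewrite mem_iota ltn_ord => /(_ isT)/eqP; rewrite /frob => ->.
  by rewrite eqxx mulr1.
move=> b; rewrite -val_eqE => ba.
have := h b; rewrite mem_iota ltn_ord => /(_ isT)/eqP; rewrite /frob => ->.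
by rewrite (negbTE ba) mulr0.
Qed.

Lemma frob_emb_onto f : diff 0 f = 0 -> exists v, f = frob_emb v.
Proof.
(* The coordinate a of the preimage is read off at the element dual to a. *)
move=> f0; exists (\row_a ev f (nth (9, 34, 34)%N dual_data a)).
apply: ev_ext => -[[s x] y] wg; have /and5P[s9 x34 y34 _ _] := wg.
have /and3P[_ /allP/(_ s) + _] := frob_emb_check; rewrite mem_iota s9 => /(_ isT)/allP/(_ x).
rewrite mem_iota x34 => /(_ isT)/allP/(_ y); rewrite mem_iota y34 => /(_ isT).
have Fout s1 x1 y1 : ~~ ((x1 < 34) && (y1 < 34))%N -> ev f (s1, x1, y1) = 0.
  by rewrite negb_and -!leqNgt => /orP[]; [apply: ev_outl|apply: ev_outr].
move=> /implyP/(_ wg)/(vanishes_sum Fout).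
have -> : filter (fun a => bm (bm x a) y \in socle) (iota 0 34) =
          filter (fun a => bm (bm x a) y \in socle) (index_iota 0 dR) by [].
rewrite big_cons big_cat [X in _ + (_ + X)]big_map.
rewrite [X in _ + (_ + X)](_ : _ = 0) ?addr0; last first.
  by rewrite -[RHS](htpy_diff_sum y f0 s9 x34); apply: eq_bigr => -[c [[s1 x1] y1]].
rewrite big_map big_filter big_mkord mulN1r => /eqP.
rewrite addrC subr_eq0 => /eqP <-; rewrite ev_frob_emb ?good_weak // big_mkcond.
by apply: eq_bigr => a _; rewrite mxE mul1r /frob; case: ifP => _; rewrite ?mulr1 ?mulr0.
Qed.

Lemma frob_emb_exact : limg frob_emb = lker (diff 0).
Proof.
apply/vspaceP => f; rewrite memv_ker; apply/memv_imgP/eqP => [[g _ ->]|f0].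
  exact: diff_frob_emb.
by have [v ->] := frob_emb_onto f0; exists v; rewrite ?memvf.
Qed.

End Modules.

(** * Centres *)

(* The basis of the sum of the e_i R e_j over the summands of Q_k. *)
Definition loops k : seq (nat * nat) :=
  [seq w <- [seq (s, z) | s <- iota 0 9, z <- iota 0 34]
  | (bm (lidem k w.1) w.2 == w.2) && (bm w.2 (ridem k w.1) == w.2)].

Arguments loops : simpl never.

Lemma mem_loops k s z : ((s, z) \in loops k) =
  [&& (s < 9)%N, (z < 34)%N, bm (lidem k s) z == z & bm z (ridem k s) == z].
Proof.
rewrite mem_filter andbC; case: (boolP (_ \in _)) => h.
  case/allpairsP: h => -[s' z'] []; rewrite !mem_iota => /= s9 z34 [-> ->].
  by rewrite s9 z34.
rewrite andFb; apply/esym/negP => /and4P[s9 z34 _ _]; case/negP: h.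
by apply/allpairsP; exists (s, z); rewrite !mem_iota.
Qed.

Lemma uniq_loops k : uniq (loops k).
Proof.
by rewrite filter_uniq // allpairs_uniq ?iota_uniq // => -[a b] [c e] _ _ [-> ->].
Qed.

Lemma loops_per k : loops (per k) = loops k.
Proof.
by apply: eq_filter => w; rewrite /lidem /ridem /summands per_id.
Qed.

Lemma loops_perS k : loops (per k).+1 = loops k.+1.
Proof.
by apply: eq_filter => w; rewrite /lidem /ridem /summands perS.
Qed.

(* Otherwise unification unfolds [loops k] and [loops k.+1] to compare them. *)
Opaque loops.

Definition loop_at k i := nth (9, 34)%N (loops k) i.

Arguments loop_at : simpl never.

Lemma loop_at_eq k (i j : 'I_(size (loops k))) :
  (loop_at k i == loop_at k j) = (i == j).
Proof. by rewrite nth_uniq ?uniq_loops ?ltn_ord. Qed.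

Section Centers.
Variable K : fieldType.
Local Notation mul := (@mulR K).
Local Notation mulA := (@mulR_A K).
Local Notation coind := (coind K).
Local Notation diff := (diff K).
Local Notation cen k := (center mulA (coind k)).

(** A central f satisfies f(x (x) y) = f(e_i (x) xy), so its values at the elements e_i (x) z, with
    z in the basis of e_i R e_j, determine it. *)
Definition loopv k : 'Hom(coind k, 'rV[K]_(size (loops k))) :=
  linfun (fun f : coind k => \row_i
    ev f ((loop_at k i).1, lidem k (loop_at k i).1, (loop_at k i).2)).

Lemma loopvE k (f : coind k) i : loopv k f 0 i =
  ev f ((loop_at k i).1, lidem k (loop_at k i).1, (loop_at k i).2).
Proof.
rewrite linfunE ?mxE // => c g h; apply/rowP => j; rewrite !mxE.
exact: evP.
Qed.

Lemma ev_loop k (f : coind k) s z : bm (lidem k s) z = z ->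
  ev f (s, lidem k s, z) =
  \sum_i loopv k f 0 i * ((s, z) == loop_at k i)%:R.
Proof.
move=> lz; have [szl|szl] := boolP ((s, z) \in loops k).
  have [i0 i0E] : exists i0 : 'I_(size (loops k)), loop_at k i0 = (s, z).
    have szi : (index (s, z) (loops k) < size (loops k))%N by rewrite index_mem.
    by exists (Ordinal szi); apply: nth_index.
  rewrite (bigD1 i0) // loopvE.
  rewrite i0E eqxx mulr1 /=.
  rewrite big1 ?addr0 // => i ii0.
  by rewrite -i0E loop_at_eq eq_sym (negbTE ii0) mulr0.
rewrite big1 => [|i _]; last first.
  case: eqP => [h|]; rewrite ?mulr0 //; case/negP: szl.
  by rewrite h mem_nth.
apply: ev_bad; apply/negP => /and5P[s9 _ z34 _ zr].
by rewrite mem_loops s9 z34 lz eqxx zr in szl.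
Qed.

(** Centrality means f(ua (x) y) = f(u (x) ay); take u = e_i and a = x. *)
Lemma central_ev k (f : coind k) s x y : f \in cen k -> weak k (s, x, y) ->
  ev f (s, x, y) = ev f (s, lidem k s, bm x y).
Proof.
move=> /centerP fC /weakP[wg|[w|w]].
- have /and5P[_ x34 _ /eqP xl _] := wg.
  have := congr1 (fun g => ev g (s, lidem k s, y)) (fC (Ordinal (x34 : x < dR)%N)).
  have wl := good_weak (good_lidem wg).
  by rewrite /= ev_lact // ev_ract //= xl.
- by rewrite ev_outl // bm_outl // ev_outr.
- by rewrite ev_outr // bm_outr // ev_outr.
Qed.

Lemma loopv_inj k (f : coind k) : f \in cen k -> loopv k f = 0 -> f = 0.
Proof.
move=> fC f0; apply: ev_ext => -[[s x] y] wg; have /and5P[_ _ _ /eqP xl _] := wg.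
rewrite (central_ev fC (good_weak wg)) ev_loop; last by rewrite -bmA xl.
by rewrite ev0 big1 // => i _; rewrite f0 mxE mul0r.
Qed.

Lemma loopv_onto k (v : 'rV[K]_(size (loops k))) :
  exists2 f, f \in cen k & loopv k f = v.
Proof.
(* Any functional v on the e_i R e_j extends to the central x (x) y |-> v(xy). *)
pose F (w : nat * nat * nat) :=
  \sum_(i < size (loops k)) v 0 i * ((w.1.1, bm w.1.2 w.2) == loop_at k i)%:R.
have Fout s x y : (34 <= bm x y)%N -> F (s, x, y) = 0.
  move=> xy; rewrite /F big1 // => i _; case: eqP => [/= h|]; rewrite ?mulr0 //.
  have := mem_nth (9, 34)%N (ltn_ord i); rewrite -/(loop_at k i) -h mem_loops.
  by move=> /and4P[_ h34 _ _]; rewrite leqNgt h34 in xy.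
have evF s x y : weak k (s, x, y) -> ev (mk k F : coind k) (s, x, y) = F (s, x, y).
  move=> /weakP[wg|[w|w]]; first by rewrite ev_mk.
    by rewrite ev_outl // Fout // bm_outl.
  by rewrite ev_outr // Fout // bm_outr.
exists (mk k F).
  apply/centerP => a; apply: ev_ext => -[[s x] y] /good_weak w.
  rewrite [LHS]ev_lact // [RHS]ev_ract // !evF ?weak_mulr ?weak_mull //.
  by rewrite /F /= bmA.
apply/rowP => j; rewrite loopvE; have := mem_nth (9, 34)%N (ltn_ord j).
rewrite -/(loop_at k j); case E : (loop_at k j) => [s z]; rewrite mem_loops.
move=> /and4P[s9 z34 /eqP lz rz]; rewrite evF; last first.
  apply/good_weak; apply: (@good_lidem k s z); apply/and5P; split=> //.
  exact/eqP.
rewrite /F /= lz -E (bigD1 j) //= eqxx mulr1 big1 ?addr0 // => i ij.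
by rewrite loop_at_eq eq_sym (negbTE ij) mulr0.
Qed.

(** The differential on centres: the transpose of z |-> sum of signed uzv from the loops of Q_(k+1)
    to those of Q_k. *)
Definition loopmx k : 'M[K]_(size (loops k), size (loops k.+1)) :=
  \matrix_(i, j) \sum_(p <- diff_terms k (loop_at k.+1 j).1)
    (-1) ^+ p.1 * ((p.2.1.1, bm (bm p.2.1.2 (loop_at k.+1 j).2) p.2.2) == loop_at k i)%:R.

Lemma loopv_diff k (f : coind k) : f \in cen k ->
  loopv k.+1 (diff k f) = loopv k f *m loopmx k.
Proof.
move=> fC; apply/rowP => j; rewrite loopvE mxE.
under eq_bigr => i _ do rewrite mxE mulr_sumr.
have := mem_nth (9, 34)%N (ltn_ord j).
rewrite -/(loop_at k.+1 j); case: (loop_at k.+1 j) => [s z]; rewrite mem_loops.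
move=> /and4P[s9 z34 lz rz]; rewrite exchange_big ev_diff; last first.
  apply/good_weak; apply: (@good_lidem k.+1 s z); exact/and5P.
apply: eq_big_seq => -[c [[s1 u] v]] ps /=.
have /and3P[/and3P[/= s19 /eqP lu rv] /= /eqP ul rv'] := diff_validP s9 ps.
rewrite (central_ev fC); last exact: (diff_term_weak _ _ s9 ps).
rewrite ul ev_loop; last by rewrite -bmA lu.
by rewrite mulr_sumr bmA; apply: eq_bigr => i _; rewrite mulrCA.
Qed.

Lemma loopv_ker k : (cen k :&: lker (loopv k) = 0)%VS.
Proof.
apply/eqP; rewrite -subv0; apply/subvP => f; rewrite memv_cap memv_ker memv0.
by move=> /andP[fC /eqP f0]; apply/eqP/loopv_inj.
Qed.

Lemma dim_rV n : \dim {:'rV[K]_n} = n.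
Proof. by rewrite dimvf /dim /= mul1n. Qed.

Lemma zdim_coind k : zdim mulA (coind k) = size (loops k).
Proof.
rewrite /zdim -(limg_dim_eq (loopv_ker k)).
have -> : (loopv k @: cen k = fullv)%VS.
  apply/eqP; rewrite eqEsubv subvf; apply/subvP => v _.
  by have [f fC <-] := loopv_onto v; apply: memv_img.
exact: dim_rV.
Qed.

Definition mulmx_hom m n (M : 'M[K]_(m, n)) : 'Hom('rV[K]_m, 'rV[K]_n) :=
  linfun (mulmxr M).

Lemma mulmx_homE m n (M : 'M[K]_(m, n)) v : mulmx_hom M v = v *m M.
Proof. by rewrite lfunE. Qed.

Lemma zker_loopmx k : zker mulA diff k = \dim (lker (mulmx_hom (loopmx k))).
Proof.
have h : (cen k :&: lker (diff k) :&: lker (loopv k) = 0)%VS.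
  by apply/eqP; rewrite -subv0 -(loopv_ker k) capvS // capvSl.
rewrite /zker -(limg_dim_eq h); congr (\dim _); apply/vspaceP => v.
rewrite memv_ker mulmx_homE; apply/memv_imgP/eqP.
  move=> [f]; rewrite memv_cap memv_ker => /andP[fC /eqP f0] ->.
  rewrite -(loopv_diff fC).
  exact: etrans (congr1 (loopv k.+1) f0) (linear0 _).
have [f fC <-] := loopv_onto v; rewrite -(loopv_diff fC) => fv0.
exists f => //; rewrite memv_cap fC memv_ker; apply/eqP.
exact: (loopv_inj (bmor_center (bmor_diff K k) fC) fv0).
Qed.

(** Since (X'X)(YY') is the unit e times the identity of size r, X has full column rank and Y full
    row rank. Hence M and X have the same left kernel, of dimension m - r. *)
Lemma dim_ker_factor m n r (e : K) (M : 'M[K]_(m, n)) (X : 'M_(m, r)) (Y : 'M_(r, n))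
    (X' : 'M_(r, m)) (Y' : 'M_(n, r)) :
  e != 0 -> M = X *m Y -> X' *m M *m Y' = e%:M ->
  (\dim (lker (mulmx_hom M)) + r = m)%N.
Proof.
move=> e0 ME XMY.
have XY : (e^-1 *: (X' *m X)) *m (Y *m Y') = 1%:M.
  by rewrite -scalemxAl mulmxA -[X' *m X *m Y]mulmxA -ME XMY scale_scalar_mx mulVf.
have YX := mulmx1C XY.
have -> : lker (mulmx_hom M) = lker (mulmx_hom X).
  apply/vspaceP => v; rewrite !memv_ker !mulmx_homE ME mulmxA.
  apply/eqP/eqP => [h|->]; last by rewrite mul0mx.
  by rewrite -[v *m X]mulmx1 -YX !mulmxA h !mul0mx.
have := limg_ker_dim (mulmx_hom X) fullv; rewrite capfv.
have -> : limg (mulmx_hom X) = fullv.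
  apply/eqP; rewrite eqEsubv subvf; apply/subvP => v _; apply/memv_imgP.
  exists (v *m (Y *m Y') *m (e^-1 *: X')); rewrite ?memvf // mulmx_homE.
  by rewrite -[_ *m X]mulmxA -scalemxAl -mulmxA YX mulmx1.
by rewrite !dim_rV.
Qed.

End Centers.

(** * Ranks *)

(* Certifies that M has rank crank when cmod = 0 and cunit <> 0 in the field:
   modulo cmod, M = X Y and X' M Y' = cunit. *)
Record rank_cert := RankCert {
  crank : nat; cmod : nat; cunit : nat;
  certX : seq (seq int); certY : seq (seq int);
  certX' : seq (seq int); certY' : seq (seq int) }.

(** One certificate over the integers per residue of k modulo 22. It is valid in every field in
    which [cunit], one of 1, 3 and 4, is invertible. *)
Definition rank_data : seq rank_cert :=
[:: RankCert 5 0 1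
[:: [:: 0; 0; 0; 0; 0]; [:: -1; 0; 0; 0; 0]; [:: 0; 1; 0; 0; 0]; [:: 0; 0; 1;
0; 0]; [:: 0; 0; 0; 0; 0]; [:: 1; -1; -1; -1; 0]; [:: 0; 0; 0; 0; 1]; [:: 0;
0; 0; 1; -1]]
[:: [:: 1; 1; 0; 0; 0; 1; 0]; [:: 0; 1; -1; 0; 0; 0; 0]; [:: 0; 0; 1; 0; -1;
0; 0]; [:: 0; 0; 0; 1; 0; 1; 0]; [:: 0; 0; 0; 0; 0; 1; -1]]
[:: [:: 0; -1; 0; 0; 0; 0; 0; 0]; [:: 0; 0; 1; 0; 0; 0; 0; 0]; [:: 0; 0; 0; 1;
0; 0; 0; 0]; [:: 0; -1; -1; -1; 0; -1; 0; 0]; [:: 0; 0; 0; 0; 0; 0; 1; 0]]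
[:: [:: 1; -1; -1; 0; -1]; [:: 0; 1; 1; 0; 0]; [:: 0; 0; 1; 0; 0]; [:: 0; 0;
0; 1; -1]; [:: 0; 0; 0; 0; 0]; [:: 0; 0; 0; 0; 1]; [:: 0; 0; 0; 0; 0]];
RankCert 1 0 1
[:: [:: 0]; [:: -1]; [:: -1]; [:: -1]; [:: -1]; [:: 1]; [:: 1]]
[:: [:: 1; 0]]
[:: [:: 0; -1; 0; 0; 0; 0; 0]]
[:: [:: 1]; [:: 0]];
RankCert 1 0 1
[:: [:: 0]; [:: 1]]
[:: [:: 1; 1; 1; 0; 0; 0; 1; 0]]
[:: [:: 0; 1]]
[:: [:: 1]; [:: 0]; [:: 0]; [:: 0]; [:: 0]; [:: 0]; [:: 0]; [:: 0]];
RankCert 7 0 4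
[:: [:: -1; 0; 0; 0; 0; 0; 0]; [:: 1; -1; 0; 0; 0; 0; 0]; [:: 0; 1; -1; 0; 0;
0; 0]; [:: -1; 1; 1; 1; 0; 0; 0]; [:: 1; 0; -1; -1; -1; 0; 0]; [:: 0; 0; 0;
-1; -1; -1; 0]; [:: 0; 0; 1; 0; 0; 0; 0]; [:: 0; 0; 0; 1; 2; 3; 4]]
[:: [:: 0; 1; 0; 1; -1; 0; 0; 0; 0]; [:: 0; 0; 0; 1; -1; 0; 0; 1; -1]; [:: 0;
0; 0; 0; 0; 1; 0; 1; -1]; [:: 1; 0; 0; 0; 1; 0; 0; -2; 2]; [:: 0; 0; 0; 0; -2;
0; 0; 1; -1]; [:: 0; 0; 0; 0; 1; 0; 0; 0; -1]; [:: 0; 0; 0; 0; 0; 0; 0; 0; 1]]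
[:: [:: -4; 0; 0; 0; 0; 0; 0; 0]; [:: -4; -4; 0; 0; 0; 0; 0; 0]; [:: -4; -4;
-4; 0; 0; 0; 0; 0]; [:: 4; 8; 4; 4; 0; 0; 0; 0]; [:: -4; -4; 0; -4; -4; 0; 0;
0]; [:: 0; -4; -4; 0; 4; -4; 0; 0]; [:: 1; 3; 2; 1; -1; 3; 0; 1]]
[:: [:: 0; 0; 0; 1; 2; 3; 3]; [:: 1; -1; 0; 0; 1; 2; 2]; [:: 0; 0; 0; 0; 0; 0;
0]; [:: 0; 1; 0; 0; -1; -1; -1]; [:: 0; 0; 0; 0; 0; 1; 1]; [:: 0; 0; 1; 0; -1;
-2; -2]; [:: 0; 0; 0; 0; 0; 0; 0]; [:: 0; 0; 0; 0; 1; 2; 3]; [:: 0; 0; 0; 0;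
0; 0; 1]];
RankCert 2 0 1
[:: [:: 0; 0]; [:: 0; 0]; [:: -1; 0]; [:: 0; 0]; [:: 0; 0]; [:: 0; 0]; [:: 0;
1]; [:: 0; 0]; [:: 0; 0]]
[:: [:: 1; 0; 0; -1; -1; 1; -1; 1]; [:: 0; 1; 1; 0; 0; -1; 1; -1]]
[:: [:: 0; 0; -1; 0; 0; 0; 0; 0; 0]; [:: 0; 0; 0; 0; 0; 0; 1; 0; 0]]
[:: [:: 1; 0]; [:: 0; 1]; [:: 0; 0]; [:: 0; 0]; [:: 0; 0]; [:: 0; 0]; [:: 0;
0]; [:: 0; 0]];
RankCert 6 0 3
[:: [:: -1; 0; 0; 0; 0; 0]; [:: 1; 1; 0; 0; 0; 0]; [:: 0; 0; -1; 0; 0; 0];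
[:: -1; -1; 1; -1; 0; 0]; [:: 1; 2; -2; 1; 0; 0]; [:: 1; 1; -1; 1; 1; 0];
[:: 0; 0; 1; 1; 3; -3]; [:: 0; 0; 1; 0; 2; -3]]
[:: [:: 1; 0; -1; -1; 0; 0; 0; 0; 0; 0; 0]; [:: 0; 0; 1; 0; 1; 0; 0; 0; 0; 0;
0]; [:: 0; 0; 0; 0; 1; 0; -1; -1; 0; 0; 0]; [:: 0; 0; 0; 1; 0; 0; -2; -2; 0;
0; 0]; [:: 0; 0; 0; 0; 0; 0; 2; 1; 0; 0; 0]; [:: 0; 0; 0; 0; 0; 0; 1; 0; 0; 0;
0]]
[:: [:: -3; 0; 0; 0; 0; 0; 0; 0]; [:: 3; 3; 0; 0; 0; 0; 0; 0]; [:: 0; 0; -3;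
0; 0; 0; 0; 0]; [:: 0; -3; -3; -3; 0; 0; 0; 0]; [:: 0; 0; 0; 3; 0; 3; 0; 0];
[:: 0; -1; -2; 2; 0; 3; -1; 0]]
[:: [:: 1; 1; -1; 1; 1; -1]; [:: 0; 0; 0; 0; 0; 0]; [:: 0; 1; -1; 0; -1; 1];
[:: 0; 0; 0; 1; 2; -2]; [:: 0; 0; 1; 0; 1; -1]; [:: 0; 0; 0; 0; 0; 0]; [:: 0;
0; 0; 0; 0; 1]; [:: 0; 0; 0; 0; 1; -2]; [:: 0; 0; 0; 0; 0; 0]; [:: 0; 0; 0; 0;
0; 0]; [:: 0; 0; 0; 0; 0; 0]];
RankCert 4 0 1
[:: [:: 0; 0; 0; 0]; [:: 1; 0; 0; 0]; [:: 0; 0; 0; 0]; [:: 0; 0; 0; 0]; [:: 0;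
0; 0; 0]; [:: -1; -1; 0; 0]; [:: 0; 0; 0; 0]; [:: 0; 0; 0; 0]; [:: 1; 1; 1;
0]; [:: 0; 1; 0; -1]; [:: 0; 0; 0; 1]]
[:: [:: 0; 1; 0; -1; 0; 0; 1; -1]; [:: 0; 0; 0; 1; 1; 1; 0; 1]; [:: 1; 0; 1;
0; -1; -1; 0; 0]; [:: 0; 0; 0; 0; 1; 0; 0; 1]]
[:: [:: 0; 1; 0; 0; 0; 0; 0; 0; 0; 0; 0]; [:: 0; -1; 0; 0; 0; -1; 0; 0; 0; 0;
0]; [:: 0; 0; 0; 0; 0; 1; 0; 0; 1; 0; 0]; [:: 0; -1; 0; 0; 0; -1; 0; 0; 0; -1;
0]]
[:: [:: 0; 0; 0; 0]; [:: 1; 1; 0; -1]; [:: 0; 0; 1; 1]; [:: 0; 1; 0; -1];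
[:: 0; 0; 0; 1]; [:: 0; 0; 0; 0]; [:: 0; 0; 0; 0]; [:: 0; 0; 0; 0]];
RankCert 3 0 1
[:: [:: -1; 0; 0]; [:: 0; -1; 0]; [:: 1; 0; 0]; [:: 0; 0; -1]; [:: 0; 0; -1];
[:: 0; 0; 1]; [:: 0; 1; 0]; [:: 0; 0; 1]]
[:: [:: 1; 0; 0; 0; 0; 0]; [:: 0; 0; 1; 0; 0; 0]; [:: 0; 1; 0; 0; 0; 0]]
[:: [:: -1; 0; 0; 0; 0; 0; 0; 0]; [:: 0; -1; 0; 0; 0; 0; 0; 0]; [:: 0; 0; 0;
-1; 0; 0; 0; 0]]
[:: [:: 1; 0; 0]; [:: 0; 0; 1]; [:: 0; 1; 0]; [:: 0; 0; 0]; [:: 0; 0; 0];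
[:: 0; 0; 0]];
RankCert 2 0 1
[:: [:: 0; 0]; [:: 0; 0]; [:: 0; 0]; [:: -1; 0]; [:: 0; 1]; [:: 1; 1]]
[:: [:: 1; -1; -1; 0; 1]; [:: 0; 1; 1; 1; 0]]
[:: [:: 0; 0; 0; -1; 0; 0]; [:: 0; 0; 0; 0; 1; 0]]
[:: [:: 1; 1]; [:: 0; 1]; [:: 0; 0]; [:: 0; 0]; [:: 0; 0]];
RankCert 2 0 1
[:: [:: -1; 0]; [:: -1; 0]; [:: 0; 1]; [:: 1; -1]; [:: 0; 1]]
[:: [:: 1; 0; 0; 0; 0; 0; 0; 0]; [:: 0; 0; 0; 0; 1; 0; 0; 0]]
[:: [:: -1; 0; 0; 0; 0]; [:: 0; 0; 1; 0; 0]]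
[:: [:: 1; 0]; [:: 0; 0]; [:: 0; 0]; [:: 0; 0]; [:: 0; 1]; [:: 0; 0]; [:: 0;
0]; [:: 0; 0]];
RankCert 6 0 1
[:: [:: 0; 0; 0; 0; 0; 0]; [:: -1; 0; 0; 0; 0; 0]; [:: 1; -1; 0; 0; 0; 0];
[:: 0; 1; 1; 0; 0; 0]; [:: 0; 0; 0; 0; 0; 0]; [:: -1; 1; 0; -1; 0; 0]; [:: -1;
1; 1; -1; 1; 0]; [:: 1; -1; 0; 0; 1; 1]]
[:: [:: 2; 0; 1; 1; 1; 0; -1; 1]; [:: 1; 0; 0; 0; 0; 0; 0; 1]; [:: 0; 0; 0; 1;
1; 0; -1; 0]; [:: 0; 0; 0; 0; 1; 0; 0; 1]; [:: 0; 0; 0; 0; 0; 0; 1; 0]; [:: 0;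
0; 0; 0; 0; 0; 0; 1]]
[:: [:: 0; -1; 0; 0; 0; 0; 0; 0]; [:: 0; -1; -1; 0; 0; 0; 0; 0]; [:: 0; 1; 1;
1; 0; 0; 0; 0]; [:: 0; 0; -1; 0; 0; -1; 0; 0]; [:: 0; -1; -1; -1; 0; -1; 1;
0]; [:: 0; 1; 0; 1; 0; 1; -1; 1]]
[:: [:: 0; 1; 0; 0; 0; -1]; [:: 0; 0; 0; 0; 0; 0]; [:: 1; -2; -1; 0; 0; 1];
[:: 0; 0; 1; -1; 1; 1]; [:: 0; 0; 0; 1; 0; -1]; [:: 0; 0; 0; 0; 0; 0]; [:: 0;
0; 0; 0; 1; 0]; [:: 0; 0; 0; 0; 0; 1]];
RankCert 2 0 1
[:: [:: 0; 0]; [:: -1; 0]; [:: 0; 0]; [:: 0; 0]; [:: 0; 0]; [:: 1; -1]; [:: 0;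
0]; [:: 0; 0]]
[:: [:: 1; 1; 0; 0; -1]; [:: 0; 1; -1; 1; -1]]
[:: [:: 0; -1; 0; 0; 0; 0; 0; 0]; [:: 0; -1; 0; 0; 0; -1; 0; 0]]
[:: [:: 1; -1]; [:: 0; 1]; [:: 0; 0]; [:: 0; 0]; [:: 0; 0]];
RankCert 2 0 1
[:: [:: -1; 0]; [:: 1; -1]; [:: 1; -1]; [:: 0; -1]; [:: 0; -1]]
[:: [:: 1; 0; -1; 0; 0; 0]; [:: 0; 1; -1; 0; 0; 0]]
[:: [:: -1; 0; 0; 0; 0]; [:: -1; -1; 0; 0; 0]]
[:: [:: 1; 0]; [:: 0; 1]; [:: 0; 0]; [:: 0; 0]; [:: 0; 0]; [:: 0; 0]];
RankCert 3 0 1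
[:: [:: 0; 0; 0]; [:: 0; 0; 0]; [:: 0; 0; 0]; [:: 1; 0; 0]; [:: 0; 1; 0];
[:: 0; 0; 1]]
[:: [:: 1; 1; 1; 0; 0; 0; 1; 0]; [:: 0; 0; 0; 1; 0; 1; 0; 0]; [:: 0; 0; 0; 0;
1; 0; 0; 1]]
[:: [:: 0; 0; 0; 1; 0; 0]; [:: 0; 0; 0; 0; 1; 0]; [:: 0; 0; 0; 0; 0; 1]]
[:: [:: 1; 0; 0]; [:: 0; 0; 0]; [:: 0; 0; 0]; [:: 0; 1; 0]; [:: 0; 0; 1];
[:: 0; 0; 0]; [:: 0; 0; 0]; [:: 0; 0; 0]];
RankCert 4 0 1
[:: [:: -1; 0; 0; 0]; [:: 0; -1; 0; 0]; [:: 1; 0; 1; 0]; [:: 0; 0; -1; 1];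
[:: 0; 0; 0; -1]; [:: 0; 0; 1; -1]; [:: 0; 1; -1; 0]; [:: 0; 0; 0; 1]]
[:: [:: 1; 0; 0; -1; 0; 0; 0; 0; 0; 0; 0]; [:: 0; 0; 1; 1; 0; 0; 0; 0; 0; 0;
0]; [:: 0; 0; 0; 1; 0; 0; 0; -1; 0; 0; 0]; [:: 0; 1; 0; 0; 0; 0; 0; 0; 0; 0;
0]]
[:: [:: -1; 0; 0; 0; 0; 0; 0; 0]; [:: 0; -1; 0; 0; 0; 0; 0; 0]; [:: 1; 0; 1;
0; 0; 0; 0; 0]; [:: 1; 0; 1; 1; 0; 0; 0; 0]]
[:: [:: 1; 0; 1; 0]; [:: 0; 0; 0; 1]; [:: 0; 1; -1; 0]; [:: 0; 0; 1; 0];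
[:: 0; 0; 0; 0]; [:: 0; 0; 0; 0]; [:: 0; 0; 0; 0]; [:: 0; 0; 0; 0]; [:: 0; 0;
0; 0]; [:: 0; 0; 0; 0]; [:: 0; 0; 0; 0]];
RankCert 6 0 3
[:: [:: 0; 0; 0; 0; 0; 0]; [:: 0; 0; 0; 0; 0; 0]; [:: 0; 0; 0; 0; 0; 0];
[:: 0; 0; 0; 0; 0; 0]; [:: -1; 0; 0; 0; 0; 0]; [:: 1; 1; 0; 0; 0; 0]; [:: 0;
0; -1; 0; 0; 0]; [:: 0; 0; 0; 0; 0; 0]; [:: 0; 0; 1; 1; 0; 0]; [:: 0; 1; 0; 0;
-1; 0]; [:: 0; 0; 0; 1; -2; 3]]
[:: [:: 1; 0; 0; -1; 1; -1; -1; 1]; [:: 0; 0; 0; 1; -1; 2; 1; -1]; [:: 0; 0;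
1; 0; 0; -1; -1; 0]; [:: 0; 1; 0; 0; -1; 1; 2; -1]; [:: 0; 0; 0; 0; -2; 2; 1;
-1]; [:: 0; 0; 0; 0; -1; 1; 0; 0]]
[:: [:: 0; 0; 0; 0; -3; 0; 0; 0; 0; 0; 0]; [:: 0; 0; 0; 0; 3; 3; 0; 0; 0; 0;
0]; [:: 0; 0; 0; 0; 0; 0; -3; 0; 0; 0; 0]; [:: 0; 0; 0; 0; 0; 0; 3; 0; 3; 0;
0]; [:: 0; 0; 0; 0; 3; 3; 0; 0; 0; -3; 0]; [:: 0; 0; 0; 0; 2; 2; -1; 0; -1;
-2; 1]]
[:: [:: 1; 1; 0; 0; 0; -1]; [:: 0; 0; 0; 1; -2; 3]; [:: 0; 0; 1; 0; 1; -1];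
[:: 0; 1; 0; 0; -1; 0]; [:: 0; 0; 0; 0; 0; 0]; [:: 0; 0; 0; 0; 0; 1]; [:: 0;
0; 0; 0; 1; -2]; [:: 0; 0; 0; 0; 0; 0]];
RankCert 2 0 1
[:: [:: -1; 0]; [:: 0; -1]; [:: 1; 1]; [:: -1; 0]; [:: 1; 0]; [:: 1; 0];
[:: 0; 1]; [:: 0; 1]]
[:: [:: 1; 0; 0; 0; 0; 0; 0; 0; 0]; [:: 0; 0; 0; 0; 1; 0; 0; 0; 0]]
[:: [:: -1; 0; 0; 0; 0; 0; 0; 0]; [:: 0; -1; 0; 0; 0; 0; 0; 0]]
[:: [:: 1; 0]; [:: 0; 0]; [:: 0; 0]; [:: 0; 0]; [:: 0; 1]; [:: 0; 0]; [:: 0;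
0]; [:: 0; 0]; [:: 0; 0]];
RankCert 7 0 4
[:: [:: 0; 0; 0; 0; 0; 0; 0]; [:: -1; 0; 0; 0; 0; 0; 0]; [:: 0; 1; 0; 0; 0; 0;
0]; [:: -1; 1; -1; 0; 0; 0; 0]; [:: 0; 0; 0; 0; 0; 0; 0]; [:: 0; 0; 0; -1; 0;
0; 0]; [:: 0; 0; 0; 0; -1; 0; 0]; [:: 0; 0; 0; 1; 0; -1; 0]; [:: 1; 0; -1; 1;
-1; -3; 4]]
[:: [:: 0; 1; 1; 1; 0; 0; 0; 1]; [:: 0; 0; 1; 1; 0; -1; 0; 0]; [:: 0; 0; 0; 1;
0; -2; 0; -1]; [:: 1; 0; 0; 0; 1; 1; 1; 0]; [:: 0; 0; 0; 0; 1; 0; 1; -1];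
[:: 0; 0; 0; 0; 0; 1; 1; 1]; [:: 0; 0; 0; 0; 0; 0; 1; 0]]
[:: [:: 0; -4; 0; 0; 0; 0; 0; 0; 0]; [:: 0; 0; 4; 0; 0; 0; 0; 0; 0]; [:: 0; 4;
4; -4; 0; 0; 0; 0; 0]; [:: 0; 0; 0; 0; 0; -4; 0; 0; 0]; [:: 0; 0; 0; 0; 0; 0;
-4; 0; 0]; [:: 0; 0; 0; 0; 0; -4; 0; -4; 0]; [:: 0; 2; 1; -1; 0; -2; -1; -3;
1]]
[:: [:: 0; 0; 0; 1; -1; -1; 1]; [:: 1; -1; 0; 0; 0; -1; 1]; [:: 0; 1; -1; 0;
0; -1; 1]; [:: 0; 0; 1; 0; 0; 2; -2]; [:: 0; 0; 0; 0; 1; 0; -1]; [:: 0; 0; 0;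
0; 0; 1; -1]; [:: 0; 0; 0; 0; 0; 0; 1]; [:: 0; 0; 0; 0; 0; 0; 0]];
RankCert 1 0 1
[:: [:: 0]; [:: 0]; [:: 0]; [:: -1]; [:: 1]; [:: -1]; [:: 0]; [:: 1]]
[:: [:: 1; 0]]
[:: [:: 0; 0; 0; -1; 0; 0; 0; 0]]
[:: [:: 1]; [:: 0]];
RankCert 1 0 1
[:: [:: 0]; [:: 1]]
[:: [:: 1; -1; 1; 1; 0; 1; -1]]
[:: [:: 0; 1]]
[:: [:: 1]; [:: 0]; [:: 0]; [:: 0]; [:: 0]; [:: 0]; [:: 0]];
RankCert 5 0 1
[:: [:: -1; 0; 0; 0; 0]; [:: -1; 1; 0; 0; 0]; [:: 0; 1; -1; 0; 0]; [:: 0; 0;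
1; 1; 0]; [:: 1; -1; 0; -1; 0]; [:: 0; 0; 0; 0; 1]; [:: 0; 0; 0; 1; 1]]
[:: [:: 1; 0; 1; 0; 0; 0; 0; 0]; [:: 0; 0; 1; 0; 0; 0; 1; 0]; [:: 0; 0; 0; 1;
0; 0; 1; 0]; [:: 0; 0; 0; 0; 1; 0; -1; 0]; [:: 0; 0; 0; 0; 0; 0; 1; 1]]
[:: [:: -1; 0; 0; 0; 0; 0; 0]; [:: -1; 1; 0; 0; 0; 0; 0]; [:: -1; 1; -1; 0; 0;
0; 0]; [:: 1; -1; 1; 1; 0; 0; 0]; [:: 0; 0; 0; 0; 0; 1; 0]]
[:: [:: 1; -1; 0; 0; 1]; [:: 0; 0; 0; 0; 0]; [:: 0; 1; 0; 0; -1]; [:: 0; 0; 1;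
0; -1]; [:: 0; 0; 0; 1; 1]; [:: 0; 0; 0; 0; 0]; [:: 0; 0; 0; 0; 1]; [:: 0; 0;
0; 0; 0]];
RankCert 2 0 3
[:: [:: 0; 0]; [:: -1; 0]; [:: 0; 0]; [:: 0; 0]; [:: 0; 0]; [:: -2; 3]; [:: 0;
0]; [:: 0; 0]]
[:: [:: 2; 0; 0; 0; 1; 0; 0; 0]; [:: 1; 0; 0; 0; 0; 0; 0; 0]]
[:: [:: 0; -3; 0; 0; 0; 0; 0; 0]; [:: 0; -2; 0; 0; 0; 1; 0; 0]]
[:: [:: 0; 1]; [:: 0; 0]; [:: 0; 0]; [:: 0; 0]; [:: 1; -2]; [:: 0; 0]; [:: 0;
0]; [:: 0; 0]]]%Z.

(* For k = 3, 5, 15, 17, 21, in characteristic [exc k]. *)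
Definition rank_mod_data : seq rank_cert :=
[:: RankCert 6 2 1
[:: [:: 1; 0; 0; 0; 0; 0]; [:: 1; 1; 0; 0; 0; 0]; [:: 0; 1; 1; 0; 0; 0];
[:: 1; 1; 1; 1; 0; 0]; [:: 1; 0; 1; 1; 1; 0]; [:: 0; 0; 0; 1; 1; 1]; [:: 0; 0;
1; 0; 0; 0]; [:: 0; 0; 0; 1; 0; 1]]
[:: [:: 0; 1; 0; 1; 1; 0; 0; 0; 0]; [:: 0; 0; 0; 1; 1; 0; 0; 1; 1]; [:: 0; 0;
0; 0; 0; 1; 0; 1; 1]; [:: 1; 0; 0; 0; 1; 0; 0; 0; 0]; [:: 0; 0; 0; 0; 0; 0; 0;
1; 1]; [:: 0; 0; 0; 0; 1; 0; 0; 0; 1]]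
[:: [:: 1; 0; 0; 0; 0; 0; 0; 0]; [:: 1; 1; 0; 0; 0; 0; 0; 0]; [:: 1; 1; 1; 0;
0; 0; 0; 0]; [:: 1; 0; 1; 1; 0; 0; 0; 0]; [:: 1; 1; 0; 1; 1; 0; 0; 0]; [:: 0;
1; 1; 0; 1; 1; 0; 0]]
[:: [:: 0; 0; 0; 1; 0; 1]; [:: 1; 1; 0; 0; 1; 0]; [:: 0; 0; 0; 0; 0; 0];
[:: 0; 1; 0; 0; 1; 1]; [:: 0; 0; 0; 0; 0; 1]; [:: 0; 0; 1; 0; 1; 0]; [:: 0; 0;
0; 0; 0; 0]; [:: 0; 0; 0; 0; 1; 0]; [:: 0; 0; 0; 0; 0; 0]];
RankCert 5 3 1
[:: [:: -1; 0; 0; 0; 0]; [:: 1; 1; 0; 0; 0]; [:: 0; 0; -1; 0; 0]; [:: -1; -1;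
1; -1; 0]; [:: 1; -1; 1; 1; 0]; [:: 1; 1; -1; 1; 1]; [:: 0; 0; 1; 1; 0];
[:: 0; 0; 1; 0; -1]]
[:: [:: 1; 0; -1; -1; 0; 0; 0; 0; 0; 0; 0]; [:: 0; 0; 1; 0; 1; 0; 0; 0; 0; 0;
0]; [:: 0; 0; 0; 0; 1; 0; -1; -1; 0; 0; 0]; [:: 0; 0; 0; 1; 0; 0; 1; 1; 0; 0;
0]; [:: 0; 0; 0; 0; 0; 0; -1; 1; 0; 0; 0]]
[:: [:: -1; 0; 0; 0; 0; 0; 0; 0]; [:: 1; 1; 0; 0; 0; 0; 0; 0]; [:: 0; 0; -1;
0; 0; 0; 0; 0]; [:: 0; -1; -1; -1; 0; 0; 0; 0]; [:: 0; 0; 0; 1; 0; 1; 0; 0]]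
[:: [:: 1; 1; -1; 1; 1]; [:: 0; 0; 0; 0; 0]; [:: 0; 1; -1; 0; -1]; [:: 0; 0;
0; 1; -1]; [:: 0; 0; 1; 0; 1]; [:: 0; 0; 0; 0; 0]; [:: 0; 0; 0; 0; 0]; [:: 0;
0; 0; 0; 1]; [:: 0; 0; 0; 0; 0]; [:: 0; 0; 0; 0; 0]; [:: 0; 0; 0; 0; 0]];
RankCert 5 3 1
[:: [:: 0; 0; 0; 0; 0]; [:: 0; 0; 0; 0; 0]; [:: 0; 0; 0; 0; 0]; [:: 0; 0; 0;
0; 0]; [:: -1; 0; 0; 0; 0]; [:: 1; 1; 0; 0; 0]; [:: 0; 0; -1; 0; 0]; [:: 0; 0;
0; 0; 0]; [:: 0; 0; 1; 1; 0]; [:: 0; 1; 0; 0; -1]; [:: 0; 0; 0; 1; 1]]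
[:: [:: 1; 0; 0; -1; 1; -1; -1; 1]; [:: 0; 0; 0; 1; -1; -1; 1; -1]; [:: 0; 0;
1; 0; 0; -1; -1; 0]; [:: 0; 1; 0; 0; -1; 1; -1; -1]; [:: 0; 0; 0; 0; 1; -1; 1;
-1]]
[:: [:: 0; 0; 0; 0; -1; 0; 0; 0; 0; 0; 0]; [:: 0; 0; 0; 0; 1; 1; 0; 0; 0; 0;
0]; [:: 0; 0; 0; 0; 0; 0; -1; 0; 0; 0; 0]; [:: 0; 0; 0; 0; 0; 0; 1; 0; 1; 0;
0]; [:: 0; 0; 0; 0; 1; 1; 0; 0; 0; -1; 0]]
[:: [:: 1; 1; 0; 0; 0]; [:: 0; 0; 0; 1; 1]; [:: 0; 0; 1; 0; 1]; [:: 0; 1; 0;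
0; -1]; [:: 0; 0; 0; 0; 0]; [:: 0; 0; 0; 0; 0]; [:: 0; 0; 0; 0; 1]; [:: 0; 0;
0; 0; 0]];
RankCert 6 2 1
[:: [:: 0; 0; 0; 0; 0; 0]; [:: 1; 0; 0; 0; 0; 0]; [:: 0; 1; 0; 0; 0; 0];
[:: 1; 1; 1; 0; 0; 0]; [:: 0; 0; 0; 0; 0; 0]; [:: 0; 0; 0; 1; 0; 0]; [:: 0; 0;
0; 0; 1; 0]; [:: 0; 0; 0; 1; 0; 1]; [:: 1; 0; 1; 1; 1; 1]]
[:: [:: 0; 1; 1; 1; 0; 0; 0; 1]; [:: 0; 0; 1; 1; 0; 1; 0; 0]; [:: 0; 0; 0; 1;
0; 0; 0; 1]; [:: 1; 0; 0; 0; 1; 1; 1; 0]; [:: 0; 0; 0; 0; 1; 0; 1; 1]; [:: 0;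
0; 0; 0; 0; 1; 1; 1]]
[:: [:: 0; 1; 0; 0; 0; 0; 0; 0; 0]; [:: 0; 0; 1; 0; 0; 0; 0; 0; 0]; [:: 0; 1;
1; 1; 0; 0; 0; 0; 0]; [:: 0; 0; 0; 0; 0; 1; 0; 0; 0]; [:: 0; 0; 0; 0; 0; 0; 1;
0; 0]; [:: 0; 0; 0; 0; 0; 1; 0; 1; 0]]
[:: [:: 0; 0; 0; 1; 1; 1]; [:: 1; 1; 0; 0; 0; 1]; [:: 0; 1; 1; 0; 0; 1];
[:: 0; 0; 1; 0; 0; 0]; [:: 0; 0; 0; 0; 1; 0]; [:: 0; 0; 0; 0; 0; 1]; [:: 0; 0;
0; 0; 0; 0]; [:: 0; 0; 0; 0; 0; 0]];
RankCert 1 3 1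
[:: [:: 0]; [:: -1]; [:: 0]; [:: 0]; [:: 0]; [:: 1]; [:: 0]; [:: 0]]
[:: [:: -1; 0; 0; 0; 1; 0; 0; 0]]
[:: [:: 0; -1; 0; 0; 0; 0; 0; 0]]
[:: [:: 0]; [:: 0]; [:: 0]; [:: 0]; [:: 1]; [:: 0]; [:: 0]; [:: 0]]]%Z.
Definition mxnth (B : seq (seq int)) i j : int := nth 0 (nth [::] B i) j.

(** * Checking the rank certificates *)

(** A plain recursion, because the generic big operators do not evaluate. *)
Fixpoint sumz (F : nat -> int) n : int := if n is m.+1 then sumz F m + F m else 0.

Definition loop_entry k (w1 w0 : nat * nat) : int :=
  foldr (fun p a =>
    (if (p.2.1.1, bm (bm p.2.1.2 w1.2) p.2.2) == w0 then (if p.1 then -1 else 1)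
     else 0) + a) 0 (diff_terms k w1.1).

Definition loop_rows k : seq (seq int) :=
  let l := loops k.+1 in [seq [seq loop_entry k w1 w0 | w1 <- l] | w0 <- loops k].

(** Divisibility by [cmod] = 0 is equality in the integers, so one test serves both kinds of
    certificate. *)
Definition cert_check k c :=
  let M := loop_rows k in
  let m := size M in let n := size (loops k.+1) in
  all (fun i => all (fun j => ((cmod c)%:Z %| mxnth M i j -
    sumz (fun l => mxnth (certX c) i l * mxnth (certY c) l j) (crank c))%Z)
    (iota 0 n)) (iota 0 m) &&
  all (fun i => all (fun j => ((cmod c)%:Z %|
    sumz (fun a => mxnth (certX' c) i a *
      sumz (fun b => mxnth M a b * mxnth (certY' c) b j) n) m
    - (if i == j then (cunit c)%:Z else 0))%Z)
    (iota 0 (crank c))) (iota 0 (crank c)).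

(* The characteristic in which the rank of the k-th matrix drops, 1 if none. *)
Definition exc k : nat :=
  if (per k \in [:: 3; 17])%N then 2%N else
  if (per k \in [:: 5; 15; 21])%N then 3%N else 1%N.

Definition cert0 := RankCert 0 0 0 [::] [::] [::] [::].
Definition rank_cert_at k := nth cert0 rank_data (per k).
Definition mod_cert_at k :=
  nth cert0 rank_mod_data (index (per k) [:: 3; 5; 15; 17; 21]%N).

Lemma rank_check :
  all (fun k => [&& cert_check k (rank_cert_at k), cmod (rank_cert_at k) == 0,
       cunit (rank_cert_at k) == (if exc k == 2 then 4 else exc k)
     & (exc k != 1) ==>
       [&& cert_check k (mod_cert_at k), cmod (mod_cert_at k) == exc k,
           cunit (mod_cert_at k) == 1
         & crank (rank_cert_at k) == (crank (mod_cert_at k)).+1]])%N (iota 0 22).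
Proof. by vm_compute. Qed.

Lemma cert_check_per k c : cert_check (per k) c = cert_check k c.
Proof.
rewrite /cert_check /loop_rows loops_per loops_perS.
suff -> : [seq [seq loop_entry (per k) w1 w0 | w1 <- loops k.+1] | w0 <- loops k] =
          [seq [seq loop_entry k w1 w0 | w1 <- loops k.+1] | w0 <- loops k] by [].
apply: eq_map => w0; apply: eq_map => w1.
by rewrite /loop_entry /diff_terms per_id.
Qed.

Lemma exc_per k : exc (per k) = exc k. Proof. by rewrite /exc per_id. Qed.

Lemma rank_checkP k :
  [/\ cert_check k (rank_cert_at k), cmod (rank_cert_at k) = 0%N,
      cunit (rank_cert_at k) = (if exc k == 2 then 4 else exc k)%N
    & exc k != 1%N ->
      [/\ cert_check k (mod_cert_at k), cmod (mod_cert_at k) = exc k,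
           cunit (mod_cert_at k) = 1%N
         & crank (rank_cert_at k) = (crank (mod_cert_at k)).+1]].
Proof.
have /allP/(_ (per k)) := rank_check; rewrite mem_iota per_small => /(_ isT).
rewrite exc_per !cert_check_per {1 2 3 4}/rank_cert_at /mod_cert_at per_id.
rewrite -/(rank_cert_at k) -/(mod_cert_at k).
move=> /and4P[-> /eqP-> /eqP-> /implyP h]; split=> // /h.
by move=> /and4P[-> /eqP-> /eqP-> /eqP->].
Qed.

Section Ranks.
Variable K : fieldType.
Local Notation mulA := (@mulR_A K).

Lemma sumzE F n : (sumz F n)%:~R = \sum_(i < n) (F i)%:~R :> K.
Proof.
elim: n => [|n IH]; first by rewrite big_ord0.
by rewrite big_ord_recr /= rmorphD /= IH.
Qed.

Lemma dvdz_intr0 (p : nat) (z : int) : p%:R = 0 :> K -> (p%:Z %| z)%Z -> z%:~R = 0 :> K.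
Proof. by move=> p0 /dvdzP[q ->]; rewrite rmorphM /= [p%:Z%:~R]p0 mulr0. Qed.

Lemma loop_entryE k (i : 'I_(size (loops k))) (j : 'I_(size (loops k.+1))) :
  loopmx K k i j = (mxnth (loop_rows k) i j)%:~R.
Proof.
rewrite mxE /mxnth /loop_rows (nth_map (9, 34)%N) // (nth_map (9, 34)%N) //.
rewrite /loop_at; move: (nth _ (loops k) i) (nth _ (loops k.+1) j) => w0 w1.
rewrite /loop_entry; elim: (diff_terms _ _) => [|p l IH]; first by rewrite big_nil.
rewrite big_cons IH /= rmorphD /=; congr (_ + _).
by case: eqP => _; case: p.1; rewrite ?mulr1 ?mulr0 ?rmorphN.
Qed.

Lemma size_loop_rows k : size (loop_rows k) = size (loops k).
Proof. exact: size_map. Qed.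

Lemma zker_cert k c : cert_check k c -> (cmod c)%:R = 0 :> K -> (cunit c)%:R != 0 :> K ->
  (zker mulA (diff K) k + crank c = size (loops k))%N.
Proof.
move=> /andP[]; rewrite size_loop_rows => /allP hM /allP hI p0 e0.
rewrite zker_loopmx.
pose mxz m n B : 'M[K]_(m, n) := \matrix_(i, j) (mxnth B i j)%:~R.
apply: (@dim_ker_factor _ _ _ _ _ _ (mxz _ _ (certX c)) (mxz _ _ (certY c))
  (mxz _ _ (certX' c)) (mxz _ _ (certY' c)) e0).
  apply/matrixP => i j; rewrite loop_entryE mxE.
  have := hM i; rewrite mem_iota add0n ltn_ord => /(_ isT)/allP/(_ (nat_of_ord j)).
  rewrite mem_iota add0n ltn_ord => /(_ isT)/(dvdz_intr0 p0)/eqP.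
  rewrite rmorphB subr_eq0 /= sumzE => /eqP->.
  by apply: eq_bigr => l _; rewrite !mxE rmorphM.
apply/matrixP => i j; rewrite -mulmxA mxE [RHS]mxE.
have := hI i; rewrite mem_iota add0n ltn_ord => /(_ isT)/allP/(_ (nat_of_ord j)).
rewrite mem_iota add0n ltn_ord => /(_ isT)/(dvdz_intr0 p0)/eqP.
rewrite rmorphB subr_eq0 /= sumzE => /eqP h.
transitivity ((if (i == j :> nat)%N then (cunit c)%:Z else 0)%:~R : K); last first.
  by rewrite -val_eqE /=; case: eqP => _; rewrite ?mulr1n ?mulr0n.
rewrite -h; apply: eq_bigr => a _; rewrite !mxE rmorphM /= sumzE; congr (_ * _).
by apply: eq_bigr => b _; rewrite loop_entryE mxE rmorphM.
Qed.

(** The membership counts as 0 or 1: the rank drops by one in the exceptional characteristic. For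
    [exc k] = 1 it is 0, a positive characteristic being prime. *)
Definition drank k := (crank (rank_cert_at k) - (exc k \in [pchar K]))%N.

Lemma zker_drank k : (zker mulA (diff K) k + drank k = size (loops k))%N.
Proof.
have [h0 m0 u0 h1] := rank_checkP k; rewrite /drank.
have [ec|ec] := boolP (exc k \in [pchar K]).
  have [|h2 m2 u2 ->] := h1; first by apply: contraL ec => /eqP->.
  rewrite subn1 /=; apply: zker_cert h2 _ _; first by rewrite m2; apply: pcharf0.
  by rewrite u2 oner_neq0.
rewrite subn0; apply: zker_cert h0 _ _; first by rewrite m0.
rewrite u0; move: ec; rewrite /exc inE /=.
case: ifP => _ /=; last case: ifP => _ /=; rewrite ?oner_neq0 //.
(* The unit 4 = 2 * 2 is nonzero as soon as 2 is. *)
by rewrite (natrM _ 2 2) mulf_eq0 orbb.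
Qed.

Lemma HHdimR0 : (HHdimR K 0 + drank 0 = size (loops 0))%N.
Proof.
rewrite /HHdimR (HHdim0_zdim mulA) -zker_drank; congr (_ + _)%N.
exact: (zdim_coresolution mulA (bmor_diff K) (@diff_exact K)
  (bmor_frob_emb K) (frob_emb_inj K) (frob_emb_exact K)).
Qed.

(** Substituting corank for [zker] in the coresolution formula cancels the size of [loops t], which
    is also the dimension of the centre of I_t. *)
Lemma HHdimRS t n : (n + drank t.+1 + drank t = size (loops t.+1))%N ->
  HHdimR K t.+1 = n.
Proof.
move=> h; apply: (HHdimS_hhdim (mulA := mulA)).
have [r0 r1] := (zker_drank t, zker_drank t.+1).
apply: (hhdim_coresolution (bmor_diff K) (relinj_coind K) (@diff_exact K)
  (bmor_frob_emb K) (frob_emb_inj K) (frob_emb_exact K)).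
by rewrite addn0 zdim_coind; lia.
Qed.

End Ranks.

(** * The dimensions as a function of t modulo 22 *)

Definition rank_seq : seq nat :=
  [:: 5; 1; 1; 7; 2; 6; 4; 3; 2; 2; 6; 2; 2; 3; 4; 6; 2; 7; 1; 1; 5; 2]%N.
Definition loops_seq : seq nat :=
  [:: 8; 7; 2; 8; 9; 8; 11; 8; 6; 5; 8; 8; 5; 6; 8; 11; 8; 9; 8; 2; 7; 8]%N.

Definition rank_val (ch2 ch3 : bool) k : nat :=
  (nth 0 rank_seq k - ((k \in [:: 3; 17]) && ch2 || (k \in [:: 5; 15; 21]) && ch3))%N.

(** Adding 21 modulo 22 gives the preceding degree. Residue 0 describes the positive multiples of
    22; in degree 0 no incoming rank is subtracted. *)
Definition hh_val ch2 ch3 k : nat :=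
  (nth 0 loops_seq k - rank_val ch2 ch3 k - rank_val ch2 ch3 ((k + 21) %% 22))%N.

Lemma loops_seqE k : size (loops k) = nth 0%N loops_seq (per k).
Proof.
rewrite -loops_per; have := per_small k; move: (per k) => n n22.
have /allP/(_ n) : all (fun n => size (loops n) == nth 0%N loops_seq n) (iota 0 22).
  by vm_compute.
by rewrite mem_iota n22 => /(_ isT)/eqP.
Qed.

Lemma drankE (K : fieldType) k :
  drank K k = rank_val (2 \in [pchar K]) (3 \in [pchar K]) (per k).
Proof.
rewrite /drank /rank_val /exc /rank_cert_at; have := per_small k.
move: (per k) => n n22; congr (_ - nat_of_bool _)%N.
  have /allP/(_ n) :
      all (fun n => crank (nth cert0 rank_data n) == nth 0%N rank_seq n) (iota 0 22).
    by vm_compute.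
  by rewrite mem_iota n22 => /(_ isT)/eqP.
case: ifP => [|_]; first by rewrite !inE => /orP[/eqP->|/eqP->]; rewrite orbF.
by case: ifP.
Qed.

(** Guarantees that the truncated subtractions in [hh_val] are genuine ones. *)
Lemma hh_val_le (ch2 ch3 : bool) k : (k < 22)%N -> ~~ (ch2 && ch3) ->
  (rank_val ch2 ch3 k + rank_val ch2 ch3 ((k + 21) %% 22) <= nth 0 loops_seq k)%N.
Proof.
move=> k22; have /allP/(_ k) : all (fun k => all (fun b : bool * bool =>
   ~~ (b.1 && b.2) ==> (rank_val b.1 b.2 k + rank_val b.1 b.2 ((k + 21) %% 22)
     <= nth 0 loops_seq k))%N [:: (true, true); (true, false); (false, true); (false, false)])
   (iota 0 22) by vm_compute.
rewrite mem_iota k22 => /(_ isT)/allP/(_ (ch2, ch3)) h h2; move: h.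
by case: ch2 h2; case: ch3 => // _ /(_ isT).
Qed.

Lemma pchar23 (K : fieldType) : ~~ ((2 \in [pchar K]) && (3 \in [pchar K])).
Proof. by apply/negP => /andP[h2 h3]; rewrite (pcharf_eq h2) in h3. Qed.

Lemma HHdimR_val (K : fieldType) t : (0 < t)%N ->
  HHdimR K t = hh_val (2 \in [pchar K]) (3 \in [pchar K]) (per t).
Proof.
case: t => // t _; apply: HHdimRS; rewrite !drankE loops_seqE.
have -> : per t = ((per t.+1 + 21) %% 22)%N.
  by rewrite /per modnDml addSn -addnS modnDr.
have := hh_val_le (per_small t.+1) (pchar23 K); rewrite /hh_val; lia.
Qed.

(** The case conditions for t > 0 depend only on r and the parity of l + m, hence only on t modulo
    22. *)
Definition cases (ch2 ch3 : bool) (k : nat) : bool :=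
  let r := (k %% 11)%N in let ev := ~~ odd (k %/ 11 + r %/ 2) in
  let caseB :=
    [|| [&& (r == 0) || (r == 10), ev & ch3]
      | [&& (r == 4) || (r == 6), ~~ ev & ch3]]%N in
  let caseC :=
    [|| [&& (r == 0) || (r == 10), ev & ~~ ch3], (r == 1) || (r == 9),
        ((r == 2) || (r == 8)) && ev, (r == 3) && (ev || ch2),
        [&& (r == 4) || (r == 6), ev & ch2],
        [&& (r == 4) || (r == 6), ~~ ev & ~~ ch3], (r == 5) && ch3
      | (r == 7) && (~~ ev || ch2)]%N in
  [&& caseB ==> (hh_val ch2 ch3 k == 2%N), caseC ==> (hh_val ch2 ch3 k == 1%N)
    & ~~ caseB ==> ~~ caseC ==> (hh_val ch2 ch3 k == 0%N)].

Lemma casesP (ch2 ch3 : bool) k : (k < 22)%N -> ~~ (ch2 && ch3) -> cases ch2 ch3 k.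
Proof.
move=> k22; have /allP/(_ k) : all (fun k => [&& cases true false k,
   cases false true k & cases false false k]) (iota 0 22) by vm_compute.
rewrite mem_iota k22 => /(_ isT)/and3P[].
by case: ch2; case: ch3.
Qed.

Theorem mainTheorem12 (K : fieldType) :
  HHdimR K 0 = 3%N /\
  forall t : nat,
    let l := (t %/ 11)%N in
    let r := (t %% 11)%N in
    let m := (r %/ 2)%N in
    let ev := ~~ odd (l + m) in
    let ch3 := 3%N \in [pchar K] in
    let ch2 := 2%N \in [pchar K] in
    let caseB :=
      [|| [&& (r == 0%N) || (r == 10%N), (0 < t)%N, ev & ch3]
        | [&& (r == 4%N) || (r == 6%N), ~~ ev & ch3]] in
    let caseC :=
      [|| [&& (r == 0%N) || (r == 10%N), (0 < t)%N, ev & ~~ ch3],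
          (r == 1%N) || (r == 9%N),
          ((r == 2%N) || (r == 8%N)) && ev,
          (r == 3%N) && (ev || ch2),
          [&& (r == 4%N) || (r == 6%N), ev & ch2],
          [&& (r == 4%N) || (r == 6%N), ~~ ev & ~~ ch3],
          (r == 5%N) && ch3
        | (r == 7%N) && (~~ ev || ch2)] in
    (caseB -> HHdimR K t = 2%N) /\
    (caseC -> HHdimR K t = 1%N) /\
    ((0 < t)%N -> ~~ caseB -> ~~ caseC -> HHdimR K t = 0%N).
Proof.
split; first by have := HHdimR0 K; rewrite drankE loops_seqE /rank_val /=; lia.
(* In degree 0 the first two case conditions are false and the third clause demands t > 0. *)
case=> [|t]; first by [].
have t0 : (0 < t.+1)%N by []; move: (t.+1) t0 => {}t t0 l r m ev ch3 ch2.
have rE : r = (per t %% 11)%N by rewrite /r /per (modn_dvdm _ (isT : 11 %| 22)%N).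
have evE : ev = ~~ odd (per t %/ 11 + (per t %% 11) %/ 2).
  (* Reducing t modulo 22 changes l by an even number, which keeps the parity of l + m. *)
  have lE : l = (t %/ 22 * 2 + per t %/ 11)%N.
    by rewrite /l {1}(divn_eq t 22) -/(per t) (mulnA _ 2 11) divnMDl.
  by rewrite /ev /m rE lE -addnA oddD oddM andbF.
rewrite t0 /= (HHdimR_val K t0) -/ch2 -/ch3.
have := casesP (per_small t) (pchar23 K); rewrite /cases -/ch2 -/ch3 -evE -rE.
case/and3P=> /implyP hB /implyP hC /implyP h0.
by split=> [/hB/eqP//|]; split=> [/hC/eqP//|_ /h0/implyP h /h/eqP].
Qed.
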